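(* There is a deterministic online algorithm for the online firefighting game on $1$-almost trees that is $(6\sqrt{n}+1)$-competitive, where $n$ is the number of vertices of the input graph. This is asymptotically optimal: no deterministic online algorithm is $o(\sqrt{n})$-competitive on $1$-almost trees.
   Context: Online firefighting game: an instance is $\mathcal{I} = (G, r, (f_i)_{i\ge 1})$, where $G$ is a finite undirected graph with $n$ vertices, $r \in V(G)$ is the fire source, and $f_i \ge 0$ are integers. The graph $G$ and $r$ are known to the algorithm in advance; $f_i$ is revealed only at the beginning of round $i$. Initially only $r$ is burning. In round $i$, after learning $f_i$, the algorithm assigns at most $f_i$ firefighters to vertices that are neither burning nor already protected (a protected vertex never burns); then the fire spreads from every burning vertex to all of its unprotected neighbours. A vertex is saved if it never burns. $\mathrm{ALG}(\mathcal{I})$ is the number of vertices saved by algorithm ALG, and $\mathrm{OPT}(\mathcal{I})$ the maximum number of vertices that can be saved by any strategy knowing the whole sequence $(f_i)$ in advance. A deterministic online algorithm makes its round-$i$ decisions as a deterministic function of $G, r, f_1,\dots,f_i$. An algorithm is $c$-competitive (where $c$ may depend on $n$) on a graph class if $\mathrm{OPT}(\mathcal{I})/\mathrm{ALG}(\mathcal{I}) \le c$ for every instance whose graph is in the class and has $n$ vertices. A $1$-almost tree is a connected graph containing at most one simple cycle. *)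

(* Defs.v *)
(* MathComp with MathComp-Analysis *)
From mathcomp Require Import all_boot all_order all_algebra.
From mathcomp Require Import boolp reals.
Import Order.TTheory GRing.Theory Num.Theory.

Set Implicit Arguments.
Unset Strict Implicit.
Unset Printing Implicit Defensive.

Record sgraph := SGraph {
  vertex :> finType;
  edge : rel vertex;
  edge_sym : symmetric edge;
  edge_irrefl : irreflexive edge
}.

Definition connected_graph (G : sgraph) : Prop :=
  forall x y : G, connect (@edge G) x y.

Definition simple_cycle (G : sgraph) (c : seq G) : bool :=
  (2 < size c) && ucycleb (@edge G) c.

(* A cycle is a subgraph, so vertex sequences that differ by a rotation or a
   reversal denote the same cycle: cycles are compared by their edge sets. *)
Definition cycle_edges (G : sgraph) (c : seq G) : {set {set G}} :=
  [set [set x; next c x] | x in c].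

Definition one_almost_tree (G : sgraph) : Prop :=
  connected_graph G /\
  forall c1 c2 : seq G, simple_cycle c1 -> simple_cycle c2 ->
    cycle_edges c1 = cycle_edges c2.

(* Rounds are numbered from 0: [f i] is the number of firefighters of the
   (i+1)-st round, and [s i] is the set of vertices newly protected in it. *)
Definition strategy (G : sgraph) : Type := nat -> {set G}.

(* The pair (burning vertices, protected vertices) after [i] rounds. *)
Fixpoint state (G : sgraph) (r : G) (s : strategy G) (i : nat) :
    {set G} * {set G} :=
  if i is j.+1 then
    let: (B, P) := state r s j in
    let P' := P :|: s j in
    (B :|: [set v | (v \notin P') && [exists u in B, edge u v]], P')
  else ([set r], set0).

Definition burning (G : sgraph) (r : G) (s : strategy G) (i : nat) : {set G} :=
  (state r s i).1.

Definition protected (G : sgraph) (r : G) (s : strategy G) (i : nat) :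
  {set G} := (state r s i).2.

Definition legal (G : sgraph) (r : G) (f : nat -> nat) (s : strategy G) :
    Prop :=
  forall i, #|s i| <= f i /\
    [disjoint s i & burning r s i :|: protected r s i].

Definition saved (G : sgraph) (r : G) (s : strategy G) : {set G} :=
  [set v | `[< forall i, v \notin burning r s i >]].

(* The range of the maximum is exhaustive, since no strategy saves more than
   #|G| vertices. *)
Definition OPT (G : sgraph) (r : G) (f : nat -> nat) : nat :=
  \max_(k < #|G|.+1 |
     `[< exists s : strategy G, legal r f s /\ #|saved r s| = k >]) k.

(* [A G r h] is the move in round [size h] (counted from 1) when the numbers of
   firefighters revealed so far are [h]. *)
Definition online_rule : Type :=
  forall G : sgraph, G -> seq nat -> {set G}.

Definition run (A : online_rule) (G : sgraph) (r : G) (f : nat -> nat) :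
  strategy G := fun i => A G r (mkseq f i.+1).

Definition online_algorithm (C : sgraph -> Prop) (A : online_rule) : Prop :=
  forall (G : sgraph) (r : G) (f : nat -> nat), C G -> legal r f (run A r f).

Definition ALG (A : online_rule) (G : sgraph) (r : G) (f : nat -> nat) : nat :=
  #|saved r (run A r f)|.

(* The ratio bound is in product form because x / 0 = 0 here: if the algorithm
   saves nothing, the bound holds only if nothing can be saved. *)
Definition competitive (R : realType) (C : sgraph -> Prop) (c : nat -> R)
    (A : online_rule) : Prop :=
  forall (G : sgraph) (r : G) (f : nat -> nat), C G ->
    ((OPT r f)%:R <= c #|G| * (ALG A r f)%:R)%R.

(* Main.v *)
(* Upper bound.  Let T = floor(sqrt n) and let B be the ball burnt when the first
   firefighter arrives.  If some vertex saves at least T vertices on its own, the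
   algorithm protects it, and n < (T+1)^2 suffices.  If all components outside B
   have at most T vertices, any first vertex will do.  Otherwise some component
   is entered from B through two edges xa and yb of the cycle; deleting either
   edge leaves a tree, with depths d1, d2.  The algorithm protects the end, a or
   b, whose remaining tree keeps T unburnt vertices for the longer time, up to a
   round tau.  All later firefighters are placed greedily.

   Let P be what OPT protects before tau.  OPT saves only vertices separated from
   the root by P, plus at most 2T vertices of depth more than tau in one of the
   trees.  The former are cut off by single vertices, of P or of the saved part
   of the arc from a to b, hence number at most T (|P| + arc).  Until tau the
   algorithm finds a use for each firefighter, so it saves at least |P| vertices
   (or T of them); and with the second firefighter it can close the arc, losing
   no more of it than OPT does whichever end OPT chose.  So OPT <= 4 T ALG.

   Lower bound.  On a cycle of length about q^2 through the root with a star of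
   size q attached at the root, one firefighter is announced.  If it goes to the
   star, a second one follows and the cycle is lost; otherwise none follows. *)
Require Import Defs.
From mathcomp Require Import all_boot.
From mathcomp Require Import boolp zify.

Set Implicit Arguments.
Unset Strict Implicit.
Unset Printing Implicit Defensive.

(** * Separation and the spread of fire *)

Definition avoid (G : sgraph) (P : {set G}) : rel G :=
  [rel u v | edge u v && (v \notin P)].

Definition sep (G : sgraph) (r : G) (P : {set G}) : {set G} :=
  [set v | ~~ connect (avoid P) r v].

Definition ball (G : sgraph) (r : G) : nat -> {set G} :=
  burning r (fun=> set0).

Lemma connect_ind (T : finType) (e : rel T) (Q : T -> Prop) (u : T) :
  Q u -> (forall v w, Q v -> e v w -> Q w) -> forall v, connect e u v -> Q v.
Proof.
move=> Qu Qe v /connectP[p]; elim: p u Qu => [|w p IH] u Qu /=; first by move=> _ ->.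
by case/andP=> uw pw; apply: IH => //; apply: Qe uw.
Qed.

Section Process.
Variables (G : sgraph) (r : G).
Implicit Types (s : strategy G) (P : {set G}).

Lemma burning0 s : burning r s 0 = [set r]. Proof. by []. Qed.

Lemma protected0 s : protected r s 0 = set0. Proof. by []. Qed.

Lemma protectedS s i : protected r s i.+1 = protected r s i :|: s i.
Proof. by rewrite /protected /=; case: (state r s i). Qed.

Lemma burningS s i : burning r s i.+1 = burning r s i :|:
  [set v | (v \notin protected r s i.+1) && [exists u in burning r s i, edge u v]].
Proof. by rewrite protectedS /burning /protected /=; case: (state r s i). Qed.

Lemma burning_sub s i j : i <= j -> burning r s i \subset burning r s j.
Proof.
elim: j => [|j IH]; first by rewrite leqn0 => /eqP->.
rewrite leq_eqVlt => /predU1P[-> //|/IH H].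
by rewrite burningS (subset_trans H) ?subsetUl.
Qed.

Lemma ball_sub i j : i <= j -> {subset ball r i <= ball r j}.
Proof. by move=> ij; apply/subsetP; apply: burning_sub. Qed.

Lemma protected_sub s i j : i <= j -> protected r s i \subset protected r s j.
Proof.
elim: j => [|j IH]; first by rewrite leqn0 => /eqP->.
rewrite leq_eqVlt => /predU1P[-> //|/IH H].
by rewrite protectedS (subset_trans H) ?subsetUl.
Qed.

Lemma root_burning s i : r \in burning r s i.
Proof. by apply: (subsetP (burning_sub s (leq0n i))); rewrite inE. Qed.

Lemma burning_step s i u v : u \in burning r s i -> edge u v ->
  v \notin protected r s i.+1 -> v \in burning r s i.+1.
Proof.
move=> ub uv vp; rewrite burningS !inE vp /=; apply/orP; right.
by apply/existsP; exists u; rewrite ub.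
Qed.

Lemma burningSE s i v : v \in burning r s i.+1 -> v \in burning r s i \/
  v \notin protected r s i.+1 /\ exists2 u, u \in burning r s i & edge u v.
Proof.
rewrite burningS !inE => /orP[|/andP[vp /existsP[u /andP[]]]]; first by left.
by right; split=> //; exists u.
Qed.

Lemma state_ext s s' i : (forall j, j < i -> s j = s' j) ->
  state r s i = state r s' i.
Proof.
elim: i => // i IH eqs /=; rewrite IH; last by move=> j ji; apply/eqs/ltnW.
by rewrite eqs.
Qed.

Lemma protected_notin s P : (forall i, s i \subset P) ->
  forall i, protected r s i \subset P.
Proof.
by move=> sP; elim=> [|i IH]; rewrite ?protected0 ?sub0set // protectedS subUset IH sP.
Qed.

Lemma burning_avoid s P v : (forall i, protected r s i \subset P) ->
  connect (avoid P) r v -> v \notin saved r s.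
Proof.
move=> sP rv; suff [i vi]: exists i, v \in burning r s i.
  by rewrite inE; apply/negP => /asboolP/(_ i); rewrite vi.
move: v rv; apply: connect_ind; first by exists 0; apply: root_burning.
move=> v w [i vi] /andP[vw wP]; exists i.+1; apply: burning_step vi vw _.
by apply: contra wP; apply/subsetP.
Qed.

Lemma savedP s v : reflect (forall i, v \notin burning r s i) (v \in saved r s).
Proof. by rewrite inE; apply: asboolP. Qed.

Lemma sep_in P v : v \in P -> v != r -> v \in sep r P.
Proof.
move=> vP vr; rewrite inE; apply/negP => rv.
suff [E|]: v = r \/ v \notin P; [by rewrite E eqxx in vr | by rewrite vP |].
move: v rv {vP vr}; apply: connect_ind; first by left.
by move=> u w _ /andP[_]; right.
Qed.

Section Legal.
Variables (f : nat -> nat) (s : strategy G).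
Hypothesis ls : legal r f s.

Lemma burning_protected i : [disjoint burning r s i & protected r s i].
Proof.
elim: i => [|i IH]; first by rewrite protected0 disjoint_sym disjoints_subset sub0set.
rewrite burningS disjoint_subset; apply/subsetP => v; rewrite !inE.
case/orP => [vb|/andP[]//].
rewrite protectedS inE negb_or (disjointFr IH vb) /=.
by have [_ /disjointFl->] := ls i; rewrite // inE vb.
Qed.

Lemma protected_saved i : protected r s i \subset saved r s.
Proof.
apply/subsetP => v vi; apply/savedP => j.
have /(subsetP (protected_sub s (leq_maxl i j))) v' := vi.
apply/negP => /(subsetP (burning_sub s (leq_maxr i j))) v''.
by rewrite (disjointFr (burning_protected _) v'') in v'.
Qed.

Lemma burning_connect i v :
  v \in burning r s i -> connect (avoid (protected r s i)) r v.
Proof.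
pose e j := [rel u w | edge u w && (w \in burning r s j)].
suff H: forall v, v \in burning r s i -> connect (e i) r v.
  move=> /H; apply: connect_sub => u w /andP[uw wi].
  by apply: connect1; rewrite /avoid /= uw (disjointFr (burning_protected i) wi).
elim: i => [|i IH] {}v; first by rewrite inE => /eqP->.
case/burningSE => [/IH|[vp [u ui uv]]].
  apply: connect_sub => u w /andP[uw wi]; apply: connect1.
  by rewrite /= uw (subsetP (burning_sub s (leqnSn i))).
apply: (@connect_trans _ _ u); last first.
  by apply: connect1; rewrite /= uv; exact: burning_step ui uv vp.
move: (IH _ ui); apply: connect_sub => x w /andP[uw wi]; apply: connect1.
by rewrite /= uw (subsetP (burning_sub s (leqnSn i))).
Qed.

Lemma sep_mono (P Q : {set G}) : P \subset Q -> sep r P \subset sep r Q.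
Proof.
move=> PQ; apply/subsetP => v; rewrite !inE; apply: contra.
apply: connect_sub => u w /andP[uw wi]; apply: connect1.
by rewrite /avoid /= uw; apply: contra wi; apply/subsetP.
Qed.

Lemma sep_saved i : sep r (protected r s i) \subset saved r s.
Proof.
apply/subsetP => v vs; apply/savedP => j.
have /(subsetP (sep_mono (protected_sub s (leq_maxl i j)))) := vs.
rewrite inE; apply: contra => /(subsetP (burning_sub s (leq_maxr i j))).
exact: burning_connect.
Qed.

Lemma card_protected_le i : #|protected r s i| <= \sum_(j < i) f j.
Proof.
elim: i => [|i IH]; first by rewrite protected0 cards0.
rewrite protectedS big_ord_recr /=; apply: leq_trans (leq_card_setU _ _) _.
by apply: leq_add IH _; case: (ls i).
Qed.

Lemma card_protected_eq i : (forall j, j < i -> #|s j| = f j) ->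
  #|protected r s i| = \sum_(j < i) f j.
Proof.
elim: i => [|i IH] H; first by rewrite protected0 cards0 big_ord0.
rewrite protectedS big_ord_recr /= cardsU (_ : _ :&: _ = set0); last first.
  apply/eqP; rewrite setI_eq0 disjoint_sym; case: (ls i) => _.
  by apply: disjointWr; apply: subsetUr.
by rewrite cards0 subn0 IH ?H // => j ji; apply/H/ltnW.
Qed.

Lemma idle_state i : (forall j, j < i -> f j = 0) ->
  state r s i = (ball r i, set0).
Proof.
move=> f0; rewrite (@state_ext s (fun=> set0)).
  rewrite [LHS]surjective_pairing -/(ball r i); congr pair.
  by apply/eqP; rewrite -subset0; apply: protected_notin.
move=> j /f0 fj; apply/eqP; rewrite -cards_eq0 -leqn0 -fj.
by case: (ls j).
Qed.

Lemma burning_ball i : burning r s i \subset ball r i.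
Proof.
elim: i => // i IH; apply/subsetP => v /burningSE[vi|[_ [u ui uv]]].
  by apply: (subsetP (burning_sub _ (leqnSn i))); apply: (subsetP IH).
apply: burning_step (subsetP IH _ ui) uv _.
have := @protected_notin (fun=> set0) set0 (fun=> sub0set _) i.+1.
by rewrite subset0 => /eqP->; rewrite inE.
Qed.

Lemma ball_burning i t v : (forall j, j < i -> f j = 0) ->
  v \in ball r t -> v \in ball r i -> v \in burning r s t.
Proof.
move=> f0 vt vi; have [ti|it] := leqP t i.
  by rewrite /burning idle_state // => j jt; apply: f0; apply: leq_trans ti.
apply: (subsetP (burning_sub s (ltnW it))).
by rewrite /burning idle_state.
Qed.

Lemma protected_ball i j : (forall k, k < i -> f k = 0) ->
  [disjoint ball r i & protected r s j].
Proof.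
move=> f0; have [Eb Ep] : burning r s i = ball r i /\ protected r s i = set0.
  by rewrite /burning /protected idle_state.
have [ij|/ltnW ji] := leqP i j.
  rewrite -Eb; apply: disjointWl (burning_sub s ij) (burning_protected j).
have := protected_sub s ji; rewrite Ep subset0 => /eqP->.
by rewrite disjoint_sym disjoints_subset sub0set.
Qed.

End Legal.

End Process.

(** * Spanning trees of 1-almost trees *)

Lemma set2_eq (T : finType) (u v x y : T) : [set u; v] = [set x; y] ->
  (u = x /\ v = y) \/ (u = y /\ v = x).
Proof.
move=> E; have : u \in [set x; y] by rewrite -E set21.
have : v \in [set x; y] by rewrite -E set22.
have : x \in [set u; v] by rewrite E set21.
have : y \in [set u; v] by rewrite E set22.
rewrite !inE => /orP[]/eqP ? /orP[]/eqP ? /orP[]/eqP ? /orP[]/eqP ?; subst; auto.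
Qed.

Lemma next_last (T : eqType) (x : T) p : uniq (x :: p) -> next (x :: p) (last x p) = x.
Proof.
move=> U; rewrite next_nth mem_last index_last // nth_default //.
Qed.

Definition bfs_tree (T : finType) (e : rel T) (r : T) (par : T -> T) (d : T -> nat) :=
  [/\ d r = 0, par r = r &
      forall v, v != r -> e (par v) v /\ d v = (d (par v)).+1].

Lemma bfs_tree_exists (T : finType) (e : rel T) (r : T) :
  (forall v, connect e r v) -> exists par d, bfs_tree e r par d.
Proof.
move=> conn.
pose Q v n := [exists p : n.-tuple T, path e r p && (last r p == v)].
have exQ v : exists n, Q v n.
  have /connectP[p ep ->] := conn v; exists (size p).
  by apply/existsP; exists (in_tuple p); rewrite /= ep eqxx.
pose d v := ex_minn (exQ v).
have dP v n : Q v n -> d v <= n by rewrite /d; case: ex_minnP => m _ H /H.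
have Qd v : Q v (d v) by rewrite /d; case: ex_minnP.
have d0 : d r = 0.
  by apply/eqP; rewrite -leqn0; apply: dP; apply/existsP; exists (in_tuple [::]) => /=.
have dS u v : e u v -> d v <= (d u).+1.
  move=> uv; apply: dP; have /existsP[p /andP[ep /eqP lp]] := Qd u.
  by apply/existsP; exists (rcons_tuple p v); rewrite /= rcons_path ep lp uv last_rcons eqxx.
have ex_par v : exists u, if v == r then u = r else e u v /\ d v = (d u).+1.
  have [_|vr] := eqVneq v r; first by exists r.
  have /existsP[p /andP[ep /eqP lp]] := Qd v.
  case/lastP E : (tval p) => [|q w]; first by rewrite E /= in lp; rewrite lp eqxx in vr.
  have wv : w = v by rewrite E last_rcons in lp.
  have sz : size q < d v by rewrite -(size_tuple p) E size_rcons.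
  move: ep; rewrite E rcons_path wv => /andP[eq qv].
  exists (last r q); split=> //; apply/eqP; rewrite eqn_leq dS //=.
  apply: leq_trans sz; rewrite ltnS; apply: dP.
  by apply/existsP; exists (in_tuple q); rewrite /= eq eqxx.
have [par parP] := boolp.choice ex_par.
exists par, d; split=> // [|v vr]; first by have := parP r; rewrite eqxx.
by have := parP v; rewrite (negbTE vr).
Qed.

Section Chords.
Variable G : sgraph.

Lemma edgeC (u v : G) : edge u v = edge v u. Proof. exact: edge_sym. Qed.

Lemma chord_cycle (e : rel G) (u w : G) : subrel e (@edge G) ->
  connect e u w -> edge u w -> ~~ e u w ->
  exists2 c : seq G, simple_cycle c & [set u; w] \in cycle_edges c /\
    forall z, z \in c -> e z (next c z) \/ [set z; next c z] = [set u; w].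
Proof.
move=> se /connectP[p0 ep0 lw] uw nuw.
case/shortenP: ep0 lw => p ep Up _ lw {p0}.
pose e' : rel G := [rel x y | e x y || ((x == w) && (y == u))].
have cyc : cycle e' (u :: p).
  have ewu : e' w u by rewrite /e' /= !eqxx orbT.
  rewrite /= rcons_path -lw ewu andbT.
  by apply: sub_path ep => x y xy /=; rewrite /e' /= xy.
have nw : next (u :: p) w = u by rewrite lw next_last.
exists (u :: p).
  apply/andP; split; first case: p lw ep {Up cyc nw} => [|x [|y p]] //= lw.
  - by rewrite lw edge_irrefl in uw.
  - by rewrite andbT -lw (negbTE nuw).
  rewrite /ucycleb Up andbT; apply: sub_cycle cyc => x y /= /orP[/se //|].
  by case/andP=> /eqP-> /eqP->; rewrite edgeC.
split.
- apply/imsetP; exists w; first by rewrite lw mem_last.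
  by rewrite nw setUC.
move=> z zc; have /= /orP[->|/andP[/eqP-> /eqP->]] := next_cycle cyc zc; first by left.
by right; rewrite setUC.
Qed.

Lemma two_chords (e : rel G) (u1 w1 u2 w2 : G) : one_almost_tree G ->
  subrel e (@edge G) -> symmetric e -> (forall u v, connect e u v) ->
  edge u1 w1 -> ~~ e u1 w1 -> edge u2 w2 -> ~~ e u2 w2 ->
  [set u1; w1] = [set u2; w2].
Proof.
move=> [_ C] se syme conn uw1 n1 uw2 n2.
have [c1 sc1 [in1 _]] := chord_cycle se (conn _ _) uw1 n1.
have [c2 sc2 [_ out2]] := chord_cycle se (conn _ _) uw2 n2.
move: in1; rewrite (C c1 c2) // => /imsetP[z zc Ez].
have [ez|<- //] := out2 z zc; case/set2_eq: Ez => [][E1 E2].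
  by rewrite E1 E2 ez in n1.
by rewrite syme E1 E2 ez in n1.
Qed.

Definition del (x a : G) : rel G := [rel u v | edge u v && ([set u; v] != [set x; a])].

Lemma del_sub x a : subrel (del x a) (@edge G).
Proof. by move=> u v /andP[]. Qed.

Lemma del_sym x a : symmetric (del x a).
Proof. by move=> u v; rewrite /del /= edgeC setUC. Qed.

Lemma connect_bfs_root (e : rel G) r par d v : symmetric e ->
  bfs_tree e r par d ->
  connect [rel u w | (u != r) && (par u == w)] v r.
Proof.
move=> se [_ _ pt]; have [n] := ubnP (d v); elim: n v => // n IH v dv.
have [->|vr] := eqVneq v r; first exact: connect0.
have [_ E] := pt v vr; apply: (@connect_trans _ _ (par v)); last by apply: IH; lia.
by apply: connect1; rewrite /= vr eqxx.
Qed.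

Lemma del_spanned x a r par d u v : one_almost_tree G -> edge x a ->
  bfs_tree (del x a) r par d -> del x a u v -> par v = u \/ par u = v.
Proof.
move=> oat xa bt uv.
pose t := [rel u v | (u != r) && (par u == v)].
pose e := [rel u v | t u v || t v u].
have te w z : t w z -> del x a w z.
  by case: bt => _ _ pt /andP[wr /eqP<-]; rewrite del_sym; case: (pt w wr).
have se : subrel e (del x a).
  by move=> w z /= /orP[/te //|/te]; rewrite del_sym.
have syme : symmetric e by move=> w z; rewrite /e /= orbC.
have cr w : connect e w r.
  have := connect_bfs_root w (del_sym x a) bt.
  by apply: connect_sub => y z yz; apply: connect1; apply/orP; left.
have [|nuv] := boolP (e u v).
  by rewrite /e /= => /orP[]/andP[_ /eqP]; auto.
have [uv_edge ne] := andP uv.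
have E : [set u; v] = [set x; a].
  apply: (two_chords (e := e)) => //.
  - by move=> w z /se/del_sub.
  - move=> w z; apply: connect_trans (cr w) _.
    by rewrite (sym_connect_sym syme).
  - by apply: contraTN (eqxx [set x; a]) => /se/andP[].
by rewrite E eqxx in ne.
Qed.

End Chords.

Section Ancestors.
Variables (G : sgraph) (r : G) (e : rel G) (par : G -> G) (d : G -> nat).
Hypothesis bt : bfs_tree e r par d.
Hypothesis se : subrel e (@edge G).

Definition anc (v : G) : {set G} := [set z | fconnect par v z].

Lemma anc_self v : v \in anc v. Proof. by rewrite inE. Qed.

Lemma anc_iter n v : iter n par v \in anc v.
Proof. by rewrite inE fconnect_iter. Qed.

Lemma anc_par v : anc v = v |: anc (par v).
Proof.
apply/setP => z; rewrite !inE; apply/idP/orP => [vz|[/eqP->|]].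
- have := iter_findex vz; case: findex => [<-|n]; first by left.
  by rewrite iterSr => <-; right; apply: fconnect_iter.
- exact: connect0.
- by apply: connect_trans; apply: fconnect1.
Qed.

Lemma anc_closed (B : {set G}) v : (forall u, u \in B -> par u \in B) ->
  v \in B -> anc v \subset B.
Proof.
move=> Bp vB; apply/subsetP => z; rewrite inE => vz; rewrite -(iter_findex vz).
by elim: findex => //= n; apply: Bp.
Qed.

Lemma burn_tree s t v : d v <= t -> [disjoint protected r s t & anc v] ->
  v \in burning r s t.
Proof.
case: bt => d0 _ pt; elim: t v => [|t IH] v.
  have [-> _ _|vr] := eqVneq v r; first exact: root_burning.
  by have [_ ->] := pt v vr.
have [-> _ _|vr] := eqVneq v r; first exact: root_burning.
have [pv ->] := pt v vr; rewrite ltnS => dv dis.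
apply: (@burning_step _ _ _ _ (par v)); last first.
- by rewrite (disjointFl dis) // anc_self.
- exact: se.
apply: IH dv _; apply: disjointWl (protected_sub _ _ (leqnSn t)) _.
by apply: disjointWr dis; rewrite (anc_par v) subsetUr.
Qed.

Lemma unburned_anc s t v : v \notin burning r s t -> d v <= t ->
  exists2 p, p \in protected r s t & p \in anc v.
Proof.
move=> vb dv; have : ~~ [disjoint protected r s t & anc v].
  by apply: contra vb; apply: burn_tree.
by rewrite -setI_eq0 => /set0Pn[p]; rewrite inE => /andP[]; exists p.
Qed.

Lemma anc_notin_sep (P : {set G}) v : [disjoint P & anc v] -> v \notin sep r P.
Proof.
rewrite inE negbK; case: bt => d0 _ pt.
have [n] := ubnP (d v); elim: n v => // n IH v.
have [-> _ _|vr] := eqVneq v r; first exact: connect0.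
have [pv ->] := pt v vr; rewrite ltnS => dv dis.
apply: (@connect_trans _ _ (par v)); last first.
  by apply: connect1; rewrite /avoid /= se // (disjointFl dis) // anc_self.
by apply: IH dv _; apply: disjointWr dis; rewrite (anc_par v) subsetUr.
Qed.

Lemma depth_par v : d (par v) <= d v.
Proof.
case: bt => d0 pr pt; have [->|/pt[_ ->]] := eqVneq v r; last by [].
by rewrite pr.
Qed.

Lemma depth_iter n v : d (iter n par v) = d v - n.
Proof.
case: bt => d0 pr pt; elim: n => [|n IH]; first by rewrite subn0.
rewrite iterS; have [E|/pt[_]] := eqVneq (iter n par v) r.
  by rewrite E pr d0; move: IH; rewrite E d0; lia.
by rewrite IH; lia.
Qed.

Hypothesis spanned : forall u v, e u v -> par v = u \/ par u = v.

Lemma clear_step (P : {set G}) u v : e u v -> v \notin P ->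
  [disjoint P & anc u] -> [disjoint P & anc v].
Proof.
move=> /spanned[pv|pu] vP dis; last first.
  by apply: disjointWr dis; rewrite (anc_par u) pu subsetUr.
by rewrite anc_par pv disjoint_sym -setI_eq0 setIUl setU_eq0 !setI_eq0 disjoints1 vP disjoint_sym.
Qed.

Lemma depth_step u v : e u v -> d v <= (d u).+1.
Proof.
case: bt => d0 pr pt /spanned[<-|<-].
  by have [->|/pt[_ ->]] := eqVneq v r; rewrite ?d0.
by have [->|/pt[_ ->]] := eqVneq u r; rewrite ?pr; lia.
Qed.

End Ancestors.

(** * The arc between two fronts *)

Lemma card_interval s k n (A : {set 'I_s}) :
  (forall m : 'I_s, m \in A -> k <= m < k + n) -> #|A| <= n.
Proof.
move=> H; rewrite cardE -(size_map val) -(size_iota k n).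
apply: uniq_leq_size; first by rewrite map_inj_uniq ?enum_uniq //; apply: val_inj.
by move=> m /mapP[m']; rewrite mem_enum mem_iota => /H ? ->.
Qed.

Section Front.
Variables (G : sgraph) (r : G) (i : nat) (x a : G).
Variables (par : G -> G) (d : G -> nat).
Hypothesis oat : one_almost_tree G.
Hypothesis aB : a \notin ball r i.
Hypothesis xa : edge x a.
Hypothesis bt : bfs_tree (del x a) r par d.

Let sp u v := @del_spanned G x a r par d u v oat xa bt.
Let se := @del_sub G x a.

Lemma idle_protected j : protected r (fun=> set0) j = set0 :> {set G}.
Proof. by apply/eqP; rewrite -subset0; apply: protected_notin. Qed.

Lemma del_notin u v (B : {set G}) : a \notin B -> edge u v -> u \in B -> v \in B ->
  del x a u v.
Proof.
move=> aB' uv uB vB; rewrite /del /= uv /=; apply: contraNneq aB' => /set2_eq.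
by case=> [][? ?]; subst.
Qed.

Lemma ball_depth j v : j <= i -> (v \in ball r j) = (d v <= j).
Proof.
move=> ji; apply/idP/idP => [|dv]; last first.
  by apply: (burn_tree bt se) => //; rewrite idle_protected disjoints_subset sub0set.
elim: j v ji => [|j IH] v ji; first by rewrite inE => /eqP->; case: bt => ->.
case/burningSE => [/IH|[vP [u uj uv]]]; first by move/(_ (ltnW ji)); lia.
have vj := burning_step uj uv vP.
have /(depth_step bt sp) : del x a u v.
  apply: del_notin aB uv (subsetP (burning_sub _ _ (ltnW ji)) _ uj) _.
  exact: (subsetP (burning_sub _ _ ji) _ vj).
by have := IH _ (ltnW ji) uj; lia.
Qed.

Lemma par_ball v : v \in ball r i -> par v \in ball r i.
Proof. by rewrite !ball_depth //; apply: leq_trans (depth_par bt v). Qed.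

Lemma anc_ball (P : {set G}) v : [disjoint ball r i & P] -> v \in ball r i ->
  [disjoint P & anc par v].
Proof.
move=> BP vB; rewrite disjoint_sym; apply: disjointWl BP.
exact: anc_closed par_ball vB.
Qed.

Lemma burning_depth f s t v : legal r f s -> (forall j, j < i -> f j = 0) ->
  a \in s i -> v \in burning r s t -> d v <= t.
Proof.
move=> ls f0 ai; elim: t v => [|t IH] v.
  by rewrite inE => /eqP->; case: bt => ->.
have [ti|it] := leqP t.+1 i.
  move/(subsetP (@burning_ball G r s t.+1)); by rewrite ball_depth.
have aP : a \in protected r s t.+1.
  apply: (subsetP (protected_sub _ _ it)).
  by rewrite protectedS inE ai orbT.
case/burningSE => [/IH|[vP [u ut uv]]]; first by lia.
have va : v != a by apply: contraNneq vP => ->.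
have ua : u != a.
  apply: contraTneq ut => ->.
  have /savedP := subsetP (protected_saved ls t.+1) _ aP; exact.
have /(depth_step bt sp) : del x a u v.
  rewrite /del /= uv; apply: contraNneq ua => /set2_eq[][E1 E2].
    by rewrite E2 eqxx in va.
  by rewrite E1.
by have := IH _ ut; lia.
Qed.

End Front.

(* The fire can enter one and the same component of the complement of the burnt
   ball through the two edges [x a] and [y b]; deleting either of them leaves a
   spanning tree, in which [d1], [d2] are the depths. *)
Record two_fronts (G : sgraph) (r : G) (i : nat) (x a y b : G)
    (par1 : G -> G) (d1 : G -> nat) (par2 : G -> G) (d2 : G -> nat) : Prop :=
  TwoFronts {
    fronts_oat : one_almost_tree G;
    fronts_x : x \in ball r i;
    fronts_y : y \in ball r i;
    fronts_a : a \notin ball r i;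
    fronts_b : b \notin ball r i;
    fronts_xa : edge x a;
    fronts_yb : edge y b;
    fronts_ab : a != b;
    fronts_tree1 : bfs_tree (del x a) r par1 d1;
    fronts_tree2 : bfs_tree (del y b) r par2 d2
  }.

Section Config.
Variables (G : sgraph) (r : G) (i : nat) (x a y b : G).
Variables (par1 : G -> G) (d1 : G -> nat) (par2 : G -> G) (d2 : G -> nat).
Hypothesis fronts : two_fronts r i x a y b par1 d1 par2 d2.

Let oat := fronts_oat fronts.
Let xB := fronts_x fronts.
Let yB := fronts_y fronts.
Let aB := fronts_a fronts.
Let bB := fronts_b fronts.
Let xa := fronts_xa fronts.
Let yb := fronts_yb fronts.
Let ab := fronts_ab fronts.
Let bt1 := fronts_tree1 fronts.
Let bt2 := fronts_tree2 fronts.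
Let sp1 u v := @del_spanned G x a r par1 d1 u v oat xa bt1.
Let sp2 u v := @del_spanned G y b r par2 d2 u v oat yb bt2.
Let se1 := @del_sub G x a.
Let se2 := @del_sub G y b.

Lemma chords_neq : [set x; a] != [set y; b].
Proof.
apply/eqP => /set2_eq[][E1 E2]; first by have := ab; rewrite E2 eqxx.
by have := aB; rewrite E2 yB.
Qed.

Lemma par2_a : par2 a = x.
Proof.
have /sp2[//|pxa] : del y b x a by rewrite /del /= xa chords_neq.
by have := par_ball oat bB yb bt2 xB; rewrite pxa (negbTE aB).
Qed.

Lemma depth1_b : d1 b = i.+1.
Proof.
have yb1 : del x a y b by rewrite /del /= yb eq_sym chords_neq.
have := depth_step bt1 sp1 yb1.
have := yB; have := bB; rewrite !(ball_depth oat aB xa bt1) //; lia.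
Qed.

Lemma clear_or (P : {set G}) v : [disjoint ball r i & P] -> v \notin sep r P ->
  [disjoint P & anc par1 v] \/ [disjoint P & anc par2 v].
Proof.
move=> BP; rewrite inE negbK => rv.
pose Q v := [disjoint P & anc par1 v] \/ [disjoint P & anc par2 v].
apply: (@connect_ind _ _ Q r _ _ v rv).
  left; apply: (anc_ball oat aB xa bt1 BP); exact: root_burning.
move=> u {rv}v cu /andP[uv vP].
have BQ z : z \in ball r i -> Q z.
  by move=> zB; left; apply: (anc_ball oat aB xa bt1 BP).
case: cu => cu.
- have [E|ne] := eqVneq [set u; v] [set x; a].
    case/set2_eq: E => [][E1 E2]; last by apply: BQ; rewrite E2.
    right; apply: (clear_step sp2 (u := u)) => //.
      by rewrite /del /= uv E1 E2 chords_neq.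
    by apply: (anc_ball oat bB yb bt2 BP); rewrite E1.
  by left; apply: (clear_step sp1 (u := u)) => //; rewrite /del /= uv.
- have [E|ne] := eqVneq [set u; v] [set y; b].
    case/set2_eq: E => [][E1 E2]; last by apply: BQ; rewrite E2.
    left; apply: (clear_step sp1 (u := u)) => //.
      by rewrite /del /= uv E1 E2 eq_sym chords_neq.
    by apply: (anc_ball oat aB xa bt1 BP); rewrite E1.
  by right; apply: (clear_step sp2 (u := u)) => //; rewrite /del /= uv.
Qed.

(* The part of the cycle outside the burnt ball, listed from [a] to [b]. *)
Let arc m := iter m par1 a.

Lemma arc_exits : exists m, arc m \in ball r i.
Proof.
by exists (d1 a); rewrite (ball_depth oat aB xa bt1) // (depth_iter bt1) subnn.
Qed.

Definition arc_size := ex_minn arc_exits.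

Lemma arc_notin m : m < arc_size -> arc m \notin ball r i.
Proof.
rewrite /arc_size; case: ex_minnP => k _ H mk; apply/negP => /H; lia.
Qed.

Lemma arc_size_in : arc arc_size \in ball r i.
Proof. by rewrite /arc_size; case: ex_minnP. Qed.

Lemma arc_size_gt0 : 0 < arc_size.
Proof.
have := arc_size_in; case: arc_size => //=; by rewrite (negbTE aB).
Qed.

Lemma arc_edge m : m < arc_size -> del x a (arc m.+1) (arc m).
Proof.
move=> /arc_notin mB; case: bt1 => _ _ pt; rewrite /arc iterS; apply: (pt _ _).1.
by apply: contraNneq mB; rewrite /arc => ->; apply: root_burning.
Qed.

Lemma arc_depth1_sub m : d1 (arc m) = d1 a - m.
Proof. exact: (depth_iter bt1 m a). Qed.

Lemma arc_lt m : m < arc_size -> i + m < d1 a.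
Proof.
move=> /arc_notin; rewrite (ball_depth oat aB xa bt1) // arc_depth1_sub; lia.
Qed.

Lemma par2_arc m : m < arc_size -> par2 (arc m) = if m is k.+1 then arc k else x.
Proof.
elim: m => [|m IH] ms; first exact: par2_a.
have /andP[e _] := arc_edge (ltnW ms).
have /sp2[] : del y b (arc m.+1) (arc m); last by [].
  rewrite /del /= e /=; apply: contraTneq yB => E.
  have : y \in [set arc m.+1; arc m] by rewrite E set21.
  by rewrite !inE => /orP[]/eqP->; apply: arc_notin => //; apply: ltnW.
rewrite IH ?(ltnW ms) //; case: m ms {IH e} => [|m] ms E.
  by have := arc_notin ms; rewrite -E xB.
have := arc_depth1_sub m; rewrite E arc_depth1_sub.
by have := arc_lt ms; lia.
Qed.

Lemma arc_last : arc arc_size.-1 = b.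
Proof.
have s0 := arc_size_gt0; have lts : arc_size.-1 < arc_size by lia.
have nB := arc_notin lts; have := arc_edge lts; rewrite prednK // => e.
have [E|ne] := eqVneq [set arc arc_size; arc arc_size.-1] [set y; b].
  by case/set2_eq: E => [][_] // E; rewrite E yB in nB.
have /sp2[E|E] : del y b (arc arc_size) (arc arc_size.-1).
- by case/andP: e => e _; rewrite /del /= e ne.
- rewrite par2_arc // in E; case E' : arc_size.-1 E => [|k] E.
    by move: e; rewrite -E E' /del /= eqxx andbF.
  have := arc_size_in; rewrite -E (negbTE (arc_notin _)) //; lia.
- by have := par_ball oat bB yb bt2 arc_size_in; rewrite E (negbTE nB).
Qed.

Lemma depth1_a : d1 a = i + arc_size.
Proof.
have := arc_depth1_sub arc_size.-1; rewrite arc_last depth1_b.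
by have := arc_size_gt0; lia.
Qed.

Lemma arc_inj m m' : m < arc_size -> m' < arc_size -> arc m = arc m' -> m = m'.
Proof.
move=> ms m's E; have := arc_depth1_sub m; rewrite E arc_depth1_sub depth1_a; lia.
Qed.

Lemma depth2_a : d2 a = i.+1.
Proof.
have xa2 : del y b x a by rewrite /del /= xa chords_neq.
have := depth_step bt2 sp2 xa2.
have := xB; have := aB; rewrite !(ball_depth oat bB yb bt2) //; lia.
Qed.

Lemma arc_depth2 m : m < arc_size -> d2 (arc m) = i.+1 + m.
Proof.
elim: m => [|m IH] ms; first by rewrite depth2_a addn0.
have mB := arc_notin ms; case: bt2 => _ _ pt.
have [|_ ->] := pt (arc m.+1).
  by apply: contraNneq mB => ->; apply: root_burning.
by rewrite par2_arc // IH ?(ltnW ms) // addnS.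
Qed.

Lemma par_off_arc v : v \notin ball r i -> (forall m, m < arc_size -> v != arc m) ->
  par1 v = par2 v.
Proof.
have [n] := ubnP (d1 v); elim: n v => // n IH v dv vB vD.
case: (bt1) => _ _ pt.
have vr : v != r by apply: contraNneq vB => ->; apply: root_burning.
have [/andP[e _] dE] := pt v vr.
have /sp2[//|E] : del y b (par1 v) v.
  rewrite /del /= e /=; apply/eqP => /set2_eq[][E1 E2].
    have s0 := arc_size_gt0; have /vD : arc_size.-1 < arc_size by lia.
    by rewrite arc_last E2 eqxx.
  by rewrite E2 yB in vB.
have wB : par1 v \notin ball r i.
  by apply: contra vB => /(par_ball oat bB yb bt2); rewrite E.
have [[m ms Em]|nD] := pselect (exists2 m, m < arc_size & par1 v = arc m).
  move: E; rewrite Em par2_arc //; case: m ms Em => [|m] ms Em E.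
    by rewrite -E xB in vB.
  by have /vD := ltnW ms; rewrite E eqxx.
have : par1 (par1 v) = v.
  rewrite -[RHS]E; apply: IH => //; first by move: dv; rewrite dE ltnS.
  by move=> m ms; apply/eqP => Em; apply: nD; exists m.
have wr : par1 v != r by apply: contraNneq wB => ->; apply: root_burning.
have [_] := pt _ wr => + E'; rewrite E' dE => /eqP.
by rewrite -addn2 -[X in X == _]addn0 eqn_add2l.
Qed.

Lemma arc_anc1 m m' : m <= m' -> arc m' \in anc par1 (arc m).
Proof. by move=> mm; rewrite /arc -(subnK mm) iterD; apply: anc_iter. Qed.

Lemma arc_anc2 m m' : m' <= m -> m < arc_size -> arc m' \in anc par2 (arc m).
Proof.
elim: m => [|m IH] mm ms; first by rewrite leqn0 in mm; rewrite (eqP mm) anc_self.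
move: mm; rewrite leq_eqVlt => /predU1P[->|mm]; first exact: anc_self.
by rewrite anc_par par2_arc // inE IH ?orbT // ltnW.
Qed.

Lemma anc1_arc m p : p \in anc par1 (arc m) -> p \notin ball r i ->
  exists2 m', m <= m' < arc_size & p = arc m'.
Proof.
rewrite inE => mp; rewrite -(iter_findex mp); move: (findex _ _ _) => n.
rewrite /arc -iterD => pB; exists (n + m) => //; rewrite leq_addl /= ltnNge.
apply: contra pB => /subnK <-; rewrite iterD.
elim: (_ - _) => [|k IH]; first exact: arc_size_in.
exact: (par_ball oat aB xa bt1).
Qed.

Lemma anc2_arc m p : m < arc_size -> p \in anc par2 (arc m) -> p \notin ball r i ->
  exists2 m', m' <= m & p = arc m'.
Proof.
move=> ms + pB; elim: m ms => [|m IH] ms; rewrite anc_par in_setU1.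
  case/predU1P => [->|]; first by exists 0.
  by rewrite par2_a => /(subsetP (anc_closed (par_ball oat bB yb bt2) xB)); rewrite (negbTE pB).
case/predU1P => [->|]; first by exists m.+1.
by rewrite par2_arc // => /(IH (ltnW ms))[m' mm ->]; exists m' => //; lia.
Qed.

Definition arc_set : {set G} := [set iter m par1 a | m : 'I_arc_size].

Lemma arc_in m : m < arc_size -> arc m \in arc_set.
Proof. by move=> ms; apply/imsetP; exists (Ordinal ms). Qed.

(* Climb from [v] towards the root as long as both trees have the same parent and
   [P] is not met; the climb ends in [P] or on the arc. *)
Lemma sep_cover (P : {set G}) v : [disjoint ball r i & P] -> v \in sep r P ->
  exists2 p, p \in P :|: (arc_set :&: sep r P) & v \in sep r [set p].
Proof.
move=> BP; have [n] := ubnP (d1 v); elim: n v => // n IH v dv vP.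
have vB : v \notin ball r i.
  apply: contraL vP => vB; apply: (anc_notin_sep bt1 se1).
  exact: (anc_ball oat aB xa bt1 BP).
have vr : v != r by apply: contraNneq vB => ->; apply: root_burning.
have [vM|] := boolP (v \in P :|: (arc_set :&: sep r P)).
  by exists v => //; apply: sep_in; rewrite ?inE.
rewrite inE negb_or inE vP andbT => /andP[vnP vD].
have pE : par1 v = par2 v.
  apply: par_off_arc vB _ => m ms; apply: contraNneq vD => ->; exact: arc_in.
case: (bt1) (bt2) => _ _ pt1 [_ _ pt2].
have [/andP[e1 _] dv1] := pt1 v vr.
have [||p pM vp] := IH (par1 v); first by move: dv; rewrite dv1 ltnS.
  rewrite inE; apply: contraL vP => rp; rewrite inE negbK.
  by apply: connect_trans rp _; apply: connect1; rewrite /avoid /= e1.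
exists p => //; have pB : p \notin ball r i.
  move: pM; rewrite inE => /orP[|]; first by apply: contraL => /(disjointFr BP)->.
  by case/setIP => /imsetP[m _ ->] _; apply: arc_notin.
have Bp : [disjoint ball r i & [set p]] by rewrite disjoint_sym disjoints1.
apply/negPn/negP => /(clear_or Bp) cl; have : par1 v \in sep r [set p] by [].
apply/negP; case: cl => cl.
  apply: (anc_notin_sep bt1 se1); apply: disjointWr cl.
  by rewrite (anc_par par1 v) subsetUr.
rewrite pE; apply: (anc_notin_sep bt2 se2); apply: disjointWr cl.
by rewrite (anc_par par2 v) subsetUr.
Qed.

(* A single firefighter before round [t] leaves one end of the arc open, and the
   fire eats [t - i] vertices from there. *)
Lemma arc_saved_le f s t : legal r f s -> (forall j, j < i -> f j = 0) ->
  i <= t -> \sum_(j < t) f j <= 1 ->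
  #|arc_set :&: saved r s| <= maxn 1 (arc_size - (t - i)).
Proof.
move=> ls f0 it ft.
pose A : {set 'I_arc_size} := [set m : 'I_arc_size | arc m \in saved r s].
apply: (@leq_trans #|A|).
  apply: leq_trans (leq_imset_card (fun m : 'I_arc_size => arc m) A).
  apply: subset_leq_card; apply/subsetP => v /setIP[/imsetP[m _ ->] ms].
  by apply/imsetP; exists m; rewrite // inE.
have K1 : #|protected r s t| <= 1 := leq_trans (card_protected_le ls t) ft.
have pB p : p \in protected r s t -> p \notin ball r i.
  by move=> pt; rewrite (disjointFl (protected_ball ls t f0) pt).
have hit2 m : m \in A -> m < t - i ->
    exists2 m', m' <= m & arc m' \in protected r s t.
  rewrite inE => /savedP/(_ t) mb mt.
  have [|p pt] := unburned_anc bt2 se2 mb; first by rewrite arc_depth2 //; lia.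
  move=> /anc2_arc[//||m' mm E]; first exact: pB.
  by exists m'; rewrite // -E.
have hit1 m : m \in A -> arc_size - (t - i) <= m ->
    exists2 m', m <= m' < arc_size & arc m' \in protected r s t.
  rewrite inE => /savedP/(_ t) mb mt.
  have [|p pt] := unburned_anc bt1 se1 mb.
    by rewrite arc_depth1_sub depth1_a; have := ltn_ord m; lia.
  move=> /anc1_arc[|m' mm E]; first exact: pB.
  by exists m'; rewrite // -E.
have [[m mA mt]|n2] := pselect (exists2 m, m \in A & m < t - i); last first.
  apply: leq_trans (leq_maxr _ _); apply: (card_interval (k := t - i)) => m mA.
  have := ltn_ord m; case: (ltnP m (t - i)) => [mt|]; last by lia.
  by case: n2; exists m.
have [[m' mA' mt']|n1] := pselect (exists2 m, m \in A & arc_size - (t - i) <= m);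
    last first.
  apply: leq_trans (leq_maxr _ _); apply: (card_interval (k := 0)) => l lA /=.
  rewrite add0n ltnNge; apply/negP => lt; apply: n1; by exists l.
have [j jm jP] := hit2 m mA mt.
have uniq_j l : l < arc_size -> arc l \in protected r s t -> l = j.
  move=> ls' lP; apply: arc_inj => //; first exact: leq_ltn_trans jm (ltn_ord m).
  by apply: (card_le1_eqP K1).
have m'j : m' <= j.
  by have [j' /andP[mj js] /uniq_j <-] := hit1 m' mA' mt'.
apply: leq_trans (leq_maxl _ _); apply: (card_interval (k := j)) => l lA.
have jl : l < t - i -> j <= l.
  by move=> /(hit2 l lA)[k kl /uniq_j <- //]; exact: leq_ltn_trans kl (ltn_ord l).
have lj : arc_size - (t - i) <= l -> l <= j.
  by move=> /(hit1 l lA)[k /andP[lk ks] /uniq_j <-].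
have {}lj : l <= j.
  case: (leqP (arc_size - (t - i)) l) => [/lj //|h].
  exact: leq_trans (ltnW (leq_trans h mt')) m'j.
by rewrite (jl (leq_ltn_trans (leq_trans lj jm) mt)) addn1 ltnS lj.
Qed.

Lemma arc_closing f s t c : legal r f s -> (forall j, j < i -> f j = 0) ->
  a \in s i -> i <= t ->
  (forall z, z \notin burning r s t -> #|sep r [set a; z]| <= c) ->
  arc_size - (t - i) <= c.
Proof.
move=> ls f0 ai it H; case E : (arc_size - (t - i)) => [//|m].
have mb : arc m \notin burning r s t.
  apply/negP => /(burning_depth oat aB xa bt1 ls f0 ai).
  by rewrite arc_depth1_sub depth1_a; lia.
apply: leq_trans (H _ mb).
have inj : injective (fun k : 'I_m.+1 => arc k).
  move=> k k' /arc_inj E'; apply: val_inj; apply: E';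
    [have := ltn_ord k|have := ltn_ord k']; lia.
rewrite -[m.+1]card_ord -cardsT -(card_imset _ inj); apply: subset_leq_card.
apply/subsetP => v /imsetP[k _ ->]; have km := ltn_ord k.
apply/negPn/negP => /clear_or[].
- rewrite disjoint_sym disjoints_subset; apply/subsetP => z zb; rewrite inE.
  by case/set2P: zb => ->; rewrite ?aB ?arc_notin //; lia.
- move/disjointFl/(_ (arc_anc1 (m := k) (m' := m) km)).
  by rewrite !inE eqxx orbT.
- have ks : k < arc_size by lia.
  move/disjointFl/(_ (arc_anc2 (leq0n k) ks)).
  by rewrite !inE eqxx.
Qed.

End Config.

(** * Bounds for a good first move *)

Lemma card_bigcup_le (I T : finType) (M : {set I}) (F : I -> {set T}) k :
  (forall p, p \in M -> #|F p| <= k) -> #|\bigcup_(p in M) F p| <= #|M| * k.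
Proof.
move=> H; rewrite -sum_nat_const.
apply: (big_ind2 (fun (A : {set T}) n => #|A| <= n)) => [|A m B n Am Bn|p /H //].
  by rewrite cards0.
exact: leq_trans (leq_card_setU A B) (leq_add Am Bn).
Qed.

Definition outside (G : sgraph) (B : {set G}) : rel G :=
  [rel u v | [&& edge u v, u \notin B & v \notin B]].

Definition component (G : sgraph) (B : {set G}) (v : G) : {set G} :=
  [set w | connect (outside B) v w].

Lemma outside_sym (G : sgraph) (B : {set G}) : connect_sym (outside B).
Proof.
apply: sym_connect_sym => u v; rewrite /outside /= edgeC.
by congr (_ && _); rewrite andbC.
Qed.

(* What the analysis uses about a run that stays idle before round [i] and
   spends its first firefighter there on [x]: no firefighter is wasted, and the
   second one, whenever it arrives, is worth at least any vertex available. *)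
Definition plays_first (G : sgraph) (r : G) (i : nat) (x : G) (f : nat -> nat)
    (s : strategy G) : Prop :=
  [/\ legal r f s, forall j, j < i -> f j = 0, x \in s i,
      forall j, #|s j| = f j \/ burning r s j :|: protected r s j.+1 = [set: G] &
      forall t z, i <= t -> \sum_(j < t) f j <= 1 -> 1 < \sum_(j < t.+1) f j ->
        z \notin burning r s t -> #|sep r [set x; z]| <= #|saved r s|].

Section Bounds.
Variables (G : sgraph) (r : G) (i T : nat).
Hypothesis T0 : 0 < T.
Hypothesis GT : #|G| < T.+1 ^ 2.

Lemma first_saved x f s : plays_first r i x f s -> sep r [set x] \subset saved r s.
Proof.
case=> ls _ xs _ _; apply: subset_trans (sep_saved ls i.+1).
by apply: sep_mono; rewrite sub1set protectedS inE xs orbT.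
Qed.

Lemma first_gain x f s : plays_first r i x f s -> 0 < #|saved r s|.
Proof.
case=> ls _ xs _ _; rewrite card_gt0; apply/set0Pn; exists x.
by apply: (subsetP (protected_saved ls i.+1)); rewrite protectedS inE xs orbT.
Qed.

Lemma uses_all x f s s' (N : nat -> {set G}) tau :
  plays_first r i x f s -> legal r f s' ->
  (forall j, j < tau -> T <= #|N j|) ->
  (forall j, j < tau -> [disjoint N j & burning r s j]) ->
  T <= #|saved r s| \/ #|protected r s' tau| <= #|saved r s|.
Proof.
case=> ls _ _ ex _ ls' NT Nb.
have [H|] := pselect (forall j, j < tau -> #|s j| = f j).
  right; apply: leq_trans (card_protected_le ls' _) _.
  by rewrite -(card_protected_eq ls H); apply/subset_leq_card/(protected_saved ls).
move=> /existsNP[j] /not_implyP[jt sj]; left; apply: leq_trans (NT j jt) _.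
apply: subset_leq_card; apply: subset_trans (protected_saved ls j.+1).
apply/subsetP => v vN; have [//|E] := ex j.
have : v \in [set: G] by []; rewrite -E inE.
by rewrite (disjointFr (Nb j jt) vN).
Qed.

Lemma large_bound o a : T <= a -> o <= #|G| -> o <= 4 * T * a.
Proof.
move=> Ta oG; have : T * T <= T * a by rewrite leq_mul2l Ta orbT.
have := leq_ltn_trans oG GT; have : T <= T * T by rewrite leq_pmulr.
rewrite -mulnn mulnS mulSn -(mulnA 4); move: (T * T) (T * a) => u v; lia.
Qed.

Lemma ratio_bound o p q a : o <= (p + q) * T + 2 * T -> (T <= a \/ p <= a) ->
  q <= a -> 0 < a -> o <= #|G| -> o <= 4 * T * a.
Proof.
move=> H1 [] H2 H3 H4 H5; first exact: large_bound.
apply: leq_trans H1 _; have : (p + q + 2) * T <= (4 * a) * T by rewrite leq_mul2r; lia.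
by rewrite mulnAC mulnDl.
Qed.

Lemma big_gain_bound x f s s' : T <= #|sep r [set x]| -> plays_first r i x f s' ->
  #|saved r s| <= 4 * T * #|saved r s'|.
Proof.
move=> Tx ps; apply: large_bound (max_card _).
exact: leq_trans (subset_leq_card (first_saved ps)).
Qed.

Lemma ball_full : connected_graph G -> exists j, ball r j = [set: G].
Proof.
move=> conn; have /boolp.choice[g gP] : forall v, exists j, v \in ball r j.
  move=> v; have : v \notin saved r (fun=> set0).
    apply: (@burning_avoid _ _ _ set0) => [j|]; first by rewrite idle_protected.
    move: (conn r v); apply: connect_sub => u w uw; apply: connect1.
    by rewrite /avoid /= uw inE.
  rewrite inE => /asboolP/existsNP[j /negP]; rewrite negbK; by exists j.
exists (\max_v g v); apply/setP => v; rewrite inE.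
exact: (subsetP (burning_sub _ _ (leq_bigmax v))).
Qed.

Lemma small_components_bound x f s s' : connected_graph G ->
  (forall z, z \notin ball r i -> #|component (ball r i) z| <= T) ->
  plays_first r i x f s' -> legal r f s ->
  #|saved r s| <= 4 * T * #|saved r s'|.
Proof.
move=> conn small ps ls; have [ls' f0 _ _ _] := ps.
have ex : exists j, #|~: ball r j| < T.
  by have [j E] := ball_full conn; exists j; rewrite E setCT cards0.
pose tau := ex_minn ex.
have tauT : #|~: ball r tau| < T by rewrite /tau; case: ex_minnP.
have ltau j : j < tau -> T <= #|~: ball r j|.
  rewrite /tau; case: ex_minnP => m _ H jm; rewrite leqNgt; apply/negP => /H; lia.
set P := protected r s tau.
have BP : [disjoint ball r i & P] := protected_ball ls tau f0.
apply: (@ratio_bound _ #|P| 0) => //; last exact: max_card.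
- rewrite addn0.
  have cov : saved r s \subset \bigcup_(p in P) component (ball r i) p :|: ~: ball r tau.
    apply/subsetP => v vs; rewrite in_setU in_setC -implyNb.
    apply/implyP => vU; apply/negP => vt.
    have /savedP/(_ tau)/negP := vs; apply.
    have vB : v \notin ball r i.
      by have /savedP/(_ i) := vs; rewrite /burning (idle_state ls f0).
    have {}vU p : p \in P -> p \notin component (ball r i) v.
      move=> pP; apply: contra vU => vp; apply/bigcupP; exists p => //.
      by rewrite inE outside_sym; move: vp; rewrite inE.
    suff H t : v \in ball r t -> t <= tau -> v \in burning r s t by apply: H vt _.
    elim: t v vB vU {vs vt} => [|t IH] v vB vU.
      by move=> /(ball_sub (leq0n i)); rewrite (negbTE vB).
    case/burningSE => [vt /ltnW tt|[_ [u ut uv]] tt].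
      exact: (subsetP (burning_sub _ _ (leqnSn t)) _ (IH v vB vU vt tt)).
    have vP : v \notin P.
      by apply/negP => /vU; rewrite inE connect0.
    apply: (burning_step _ uv); last first.
      by apply: contra vP; apply: (subsetP (protected_sub _ _ tt)).
    have [uB|uB] := boolP (u \in ball r i); first exact: ball_burning uB.
    apply: (IH _ uB _ ut (ltnW tt)) => p /vU; apply: contra; rewrite !inE.
    by apply: connect_trans; apply: connect1; rewrite /outside /= edgeC uv vB.
  apply: leq_trans (subset_leq_card cov) _.
  apply: leq_trans (leq_card_setU _ _) _; apply: leq_add; last by lia.
  apply: card_bigcup_le => p pP; apply: small.
  by rewrite (disjointFl BP pP).
- apply: (uses_all (N := fun j => ~: ball r j) ps ls) => // j _.
  by rewrite disjoint_sym disjoints_subset setCK burning_ball.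
- exact: first_gain ps.
Qed.

Lemma two_fronts_bound x a y b par1 d1 par2 d2 tau f s s' :
  two_fronts r i x a y b par1 d1 par2 d2 ->
  (forall z, z \notin ball r i -> #|sep r [set z]| <= T) ->
  #|[set v | tau < d1 v]| < T -> #|[set v | tau < d2 v]| < T ->
  (forall j, j < tau -> T <= #|[set v | j < d1 v]|) ->
  plays_first r i a f s' -> legal r f s ->
  #|saved r s| <= 4 * T * #|saved r s'|.
Proof.
move=> H small N1 N2 ltau ps ls.
have [ls' f0 ai _ second] := ps.
set P := protected r s tau.
have BP : [disjoint ball r i & P] := protected_ball ls tau f0.
pose arcs := arc_set H.
apply: (@ratio_bound _ #|P| #|arcs :&: saved r s|); last exact: max_card.
- have cov : saved r s \subset sep r P :|: ([set v | tau < d1 v] :|: [set v | tau < d2 v]).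
    apply/subsetP => v /savedP/(_ tau) vs.
    rewrite in_setU -implyNb; apply/implyP.
    move/(clear_or H BP) => cl.
    rewrite !inE !ltnNge -negb_and; apply: contra vs => /andP[v1 v2].
    case: cl => cl; first exact: (burn_tree (fronts_tree1 H) (@del_sub _ _ _)).
    exact: (burn_tree (fronts_tree2 H) (@del_sub _ _ _)).
  apply: leq_trans (subset_leq_card cov) _.
  apply: leq_trans (leq_card_setU _ _) _; apply: leq_add; last first.
    apply: leq_trans (leq_card_setU _ _) _.
    by rewrite mul2n -addnn; apply: leq_add; apply: ltnW.
  have M : #|P :|: (arcs :&: sep r P)| <= #|P| + #|arcs :&: saved r s|.
    apply: leq_trans (leq_card_setU _ _) _; rewrite leq_add2l.
    by apply: subset_leq_card; apply: setIS; exact: (sep_saved ls tau).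
  apply: leq_trans (leq_mul M (leqnn T)).
  apply: leq_trans (card_bigcup_le (F := fun p => sep r [set p]) _); last first.
    move=> p; rewrite inE => /orP[pP|]; first by apply: small; rewrite (disjointFl BP pP).
    by case/setIP=> /imsetP[m _ ->] _; apply: small; exact: arc_notin (ltn_ord m).
  apply: subset_leq_card; apply/subsetP => v vP.
  have [p pM vp] := sep_cover H BP vP.
  by apply/bigcupP; exists p.
- apply: (uses_all (N := fun j => [set v | j < d1 v]) ps ls) => // j _.
  rewrite disjoint_sym disjoints_subset; apply/subsetP => v vb.
  rewrite !inE -leqNgt; apply: (burning_depth _ _ _ (fronts_tree1 H) ls' f0 ai vb).
  - exact: fronts_oat H.
  - exact: fronts_a H.
  - exact: fronts_xa H.
- have gain : 0 < #|saved r s'| by apply: first_gain ps.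
  pose F t := \sum_(j < t) f j.
  have [ex|never] := pselect (exists t, 1 < F t.+1).
    have [t Ft tmin] := ex_minnP ex.
    have Ft1 : F t <= 1.
      case: t Ft tmin => [|t] Ft tmin; first by rewrite /F big_ord0.
      by rewrite leqNgt; apply/negP => /tmin; rewrite ltnn.
    have it : i <= t.
      rewrite leqNgt; apply/negP => ti; move: Ft; rewrite /F big1 // => j _.
      by apply: f0; apply: leq_trans ti.
    apply: leq_trans (arc_saved_le H ls f0 it Ft1) _.
    rewrite geq_max gain; apply: (arc_closing H ls' f0 ai it).
    by move=> z; apply: second.
  have F1 t : F t <= 1.
    case: t => [|t]; first by rewrite /F big_ord0.
    by rewrite leqNgt; apply/negP => Ft; apply: never; exists t.
  apply: leq_trans (arc_saved_le H ls f0 (leq_addr (arc_size H) i) (F1 _)) _.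
  by rewrite addKn subnn maxn0.
- exact: first_gain ps.
Qed.

End Bounds.

Section FirstMove.
Variables (G : sgraph) (r : G) (i T : nat).
Hypothesis T0 : 0 < T.
Hypothesis GT : #|G| < T.+1 ^ 2.
Hypothesis oat : one_almost_tree G.
Let B := ball r i.

Definition good_first (x : G) : Prop := x \notin B /\
  forall f s s', plays_first r i x f s' -> legal r f s ->
    #|saved r s| <= 4 * T * #|saved r s'|.

Lemma connect_in_ball (e : rel G) :
  (forall u v, edge u v -> u \in B -> v \in B -> e u v) ->
  forall v, v \in B -> connect e r v.
Proof.
move=> eB v; suff H j : j <= i -> v \in ball r j -> connect e r v by apply: H.
elim: j v => [|j IH] v ji; first by rewrite inE => /eqP->.
case/burningSE => [/(IH _ (ltnW ji))//|[vP [u uj uv]]].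
apply: connect_trans (IH _ (ltnW ji) uj) _; apply: connect1; apply: (eB _ _ uv).
  exact: ball_sub (ltnW ji) _ uj.
exact: ball_sub ji _ (burning_step uj uv vP).
Qed.

Lemma del_connected x a y b : x \in B -> y \in B -> a \notin B -> b \notin B ->
  edge x a -> edge y b -> a != b -> connect (outside B) a b ->
  forall v, connect (del x a) r v.
Proof.
move=> xB yB aB bB xa yb ab abo v.
have sym := sym_connect_sym (@del_sym G x a).
have rB z : z \in B -> connect (del x a) r z.
  by apply: connect_in_ball => u w uw uB wB; apply: del_notin aB uw uB wB.
have ra : connect (del x a) r a.
  apply: connect_trans (rB y yB) _; apply: (@connect_trans _ _ b).
    apply: connect1; rewrite /del /= yb; apply: contraNneq ab => /set2_eq[][E1 E2].
      by rewrite E2.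
    by rewrite -E1 yB in aB.
  rewrite sym; apply: connect_sub abo => u w /and3P[uw uB wB]; apply: connect1.
  rewrite /del /= uw; apply: contraNneq uB => /set2_eq[][E1 E2]; first by rewrite E1.
  by rewrite E2 xB in wB.
have [conn _] := oat; move: (conn r v); apply: connect_sub => u w uw.
have [E|ne] := eqVneq [set u; w] [set x; a]; last first.
  by apply: connect1; rewrite /del /= uw.
have xa' : connect (del x a) x a by apply: connect_trans ra; rewrite sym rB.
by case/set2_eq: E => [][-> ->]; rewrite // sym.
Qed.

Lemma last_large (d : G -> nat) : exists tau, #|[set v | tau < d v]| < T /\
  forall j, j < tau -> T <= #|[set v | j < d v]|.
Proof.
have ex : exists j, #|[set v | j < d v]| < T.
  exists (\max_v d v); rewrite (_ : [set v | _] = set0) ?cards0 //.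
  by apply/setP => v; rewrite !inE ltnNge leq_bigmax.
exists (ex_minn ex); case: ex_minnP => m mT H; split=> // j jm.
by rewrite leqNgt; apply/negP => /H; rewrite leqNgt jm.
Qed.

Lemma comp_notin z a : z \notin B -> a \in component B z -> a \notin B.
Proof.
move=> zB; rewrite inE; move: a.
by apply: (@connect_ind _ _ (fun a : G => is_true (a \notin B))) => // u v _ /and3P[].
Qed.

Lemma comp_sep z (P : {set G}) : z \notin B ->
  (forall x a, x \in B -> a \in component B z -> edge x a -> a \in P) ->
  component B z \subset sep r P.
Proof.
move=> zB H; apply/subsetP => v vz; rewrite inE; apply/negP => rv.
suff : v \notin component B z by rewrite vz.
move: v rv {vz}; apply: (@connect_ind _ _ (fun v : G => is_true (v \notin component B z))).
  by apply/negP => /(comp_notin zB); rewrite root_burning.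
move=> u v uz /andP[uv vP]; apply: contra uz => vz.
have [uB|uB] := boolP (u \in B); first by rewrite (H u v uB vz uv) in vP.
rewrite inE; move: vz; rewrite inE => vz; apply: (connect_trans vz).
rewrite outside_sym; apply: connect1; rewrite /outside /= uv uB /=.
by apply: (comp_notin zB); rewrite inE.
Qed.

Lemma two_fronts_exist z : z \notin B -> T < #|component B z| ->
  (forall x, x \notin B -> #|sep r [set x]| <= T) ->
  exists x a y b, [/\ x \in B, y \in B, edge x a, edge y b & a != b] /\
    [/\ a \notin B, b \notin B & connect (outside B) a b].
Proof.
move=> zB zT small.
have front (P : {set G}) : #|sep r P| <= T -> exists x a,
    [/\ x \in B, a \in component B z, edge x a & a \notin P].
  move=> PT; apply: contrapT => none; move: zT; rewrite ltnNge => /negP; apply.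
  apply: leq_trans PT; apply/subset_leq_card/(comp_sep zB) => x a xB az xa.
  by apply: contrapT => aP; apply: none; exists x, a; split=> //; apply/negP.
have [|x [a [xB az xa _]]] := front set0.
  rewrite (_ : sep r set0 = set0) ?cards0 //; apply/setP => v; rewrite !inE.
  apply/negbTE; rewrite negbK; have [conn _] := oat; move: (conn r v).
  by apply: connect_sub => u w uw; apply: connect1; rewrite /avoid /= uw inE.
have aB := comp_notin zB az.
have [y [b [yB bz yb]]] := front [set a] (small a aB); rewrite inE => ba.
exists x, a, y, b; split; first by split; rewrite // eq_sym.
split=> //; first exact: comp_notin bz.
by move: az bz; rewrite !inE outside_sym; apply: connect_trans.
Qed.

Lemma good_first_exists : B != [set: G] -> exists x, good_first x.
Proof.
rewrite -subTset => /subsetPn[z _ zB].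
have [[x [xB xT]]|nosingle] := pselect (exists x, x \notin B /\ T < #|sep r [set x]|).
  exists x; split=> // f s s' ps ls; apply: big_gain_bound ps => //; exact: ltnW.
have small x : x \notin B -> #|sep r [set x]| <= T.
  by move=> xB; rewrite leqNgt; apply/negP => xT; apply: nosingle; exists x.
have [[w [wB wT]]|nocomp] := pselect (exists w, w \notin B /\ T < #|component B w|);
    last first.
  exists z; split=> // f s s' ps ls.
  apply: small_components_bound ps ls => //; first by case: oat.
  by move=> w wB; rewrite leqNgt; apply/negP => wT; apply: nocomp; exists w.
have [x [a [y [b [[xB yB xa yb ab] [aB bB abo]]]]]] := two_fronts_exist wB wT small.
have ba : b != a by rewrite eq_sym.
have bao : connect (outside B) b a by rewrite outside_sym.
have [p1 [d1 bt1]] := bfs_tree_exists (del_connected xB yB aB bB xa yb ab abo).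
have [p2 [d2 bt2]] := bfs_tree_exists (del_connected yB xB bB aB yb xa ba bao).
have [t1 [N1 l1]] := last_large d1.
have [t2 [N2 l2]] := last_large d2.
have anti (d : G -> nat) t t' : t <= t' -> #|[set v | t < d v]| < T ->
    #|[set v | t' < d v]| < T.
  move=> tt; apply: leq_ltn_trans; apply: subset_leq_card; apply/subsetP => v.
  by rewrite !inE; apply: leq_ltn_trans.
have [t12|/ltnW t21] := leqP t2 t1.
  exists a; split=> // f s s' ps ls.
  apply: (two_fronts_bound T0 GT (TwoFronts oat xB yB aB bB xa yb ab bt1 bt2) small N1 _ l1 ps ls).
  exact: anti N2.
exists b; split=> // f s s' ps ls.
apply: (two_fronts_bound T0 GT (TwoFronts oat yB xB bB aB yb xa ba bt2 bt1) small N2 _ l2 ps ls).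
exact: anti N1.
Qed.

End FirstMove.

(** * The algorithm *)

Definition nsqrt (n : nat) : nat := \max_(k < n.+1 | k ^ 2 <= n) k.

Lemma nsqrt_le n : nsqrt n ^ 2 <= n.
Proof.
rewrite /nsqrt; apply: (big_ind (fun m => m ^ 2 <= n)) => // p q pn qn.
by rewrite /maxn; case: ifP.
Qed.

Lemma nsqrt_gt n : n < (nsqrt n).+1 ^ 2.
Proof.
rewrite ltnNge; apply/negP => H.
have Hn : (nsqrt n).+1 < n.+1 by rewrite ltnS; apply: leq_trans H; rewrite -mulnn leq_pmulr.
have := @leq_bigmax_cond _ (fun k : 'I_n.+1 => k ^ 2 <= n) (@nat_of_ord _) (Ordinal Hn) H.
by rewrite ltnn.
Qed.

Definition greedy (G : sgraph) (r : G) (B P : {set G}) (n : nat) : {set G} :=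
  [set z in take n (sort (fun u v => #|sep r (v |: P)| <= #|sep r (u |: P)|)
                         (enum (~: (B :|: P))))].

Section Greedy.
Variables (G : sgraph) (r : G) (B P : {set G}).
Let le u v := #|sep r (v |: P)| <= #|sep r (u |: P)|.
Let ranking := sort le (enum (~: (B :|: P))).

Lemma greedy_sub n z : z \in greedy r B P n -> z \notin B /\ z \notin P.
Proof.
rewrite inE => /mem_take; rewrite mem_sort mem_enum !inE negb_or.
by case/andP.
Qed.

Lemma card_greedy n : #|greedy r B P n| = minn n #|~: (B :|: P)|.
Proof.
rewrite cardsE (card_uniqP _); last by rewrite take_uniq // sort_uniq enum_uniq.
by rewrite size_take_min size_sort -cardE.
Qed.

Lemma greedy_le n : #|greedy r B P n| <= n.
Proof. by rewrite card_greedy geq_minl. Qed.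

Lemma greedy_exhaustive n :
  #|greedy r B P n| = n \/ B :|: (P :|: greedy r B P n) = [set: G].
Proof.
have [nA|An] := leqP n #|~: (B :|: P)|.
  by left; rewrite card_greedy (minn_idPl nA).
right; rewrite setUA (_ : greedy r B P n = ~: (B :|: P)) ?setUCr //.
apply/eqP; rewrite eqEcard; apply/andP; split.
  by apply/subsetP => z /greedy_sub[]; rewrite !inE negb_or => -> ->.
by rewrite card_greedy (minn_idPr (ltnW An)).
Qed.

Lemma greedy_best n y : 0 < n -> y \notin B -> y \notin P ->
  exists2 z, z \in greedy r B P n & #|sep r (y |: P)| <= #|sep r (z |: P)|.
Proof.
case: n => // n _ yB yP.
have yr : y \in ranking by rewrite mem_sort mem_enum !inE negb_or yB.
have : sorted le ranking.
  by apply: sort_sorted => u v; rewrite /le orbC; apply: leq_total.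
rewrite /greedy -/le -/ranking; case: ranking yr => // z q.
rewrite inE => yr /=; rewrite path_sortedE; last first.
  by move=> u v w H1 H2; apply: leq_trans H2 H1.
case/andP=> /allP zq _; exists z; first by rewrite inE mem_head.
by case/predU1P: yr => [->//|/zq].
Qed.

End Greedy.

Definition next_move (G : sgraph) (r : G) (i : nat) (B P : {set G}) (n : nat) : {set G} :=
  if n is m.+1 then
    if P == set0 then
      if [pick x | (x \notin B) && `[< good_first r i (nsqrt #|G|) x >]] is Some x
      then x |: greedy r B [set x] m else set0
    else greedy r B P n
  else set0.

(* The history [h] is listed backwards, the current round first. *)
Fixpoint online_state (G : sgraph) (r : G) (h : seq nat) : {set G} * {set G} :=
  if h is n :: h' then
    let: (B, P) := online_state r h' in
    let P' := P :|: next_move r (size h') B P n in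
    (B :|: [set v | (v \notin P') && [exists u in B, edge u v]], P')
  else ([set r], set0).

Definition firefighter : online_rule := fun G r h =>
  if rev h is n :: h' then
    let: (B, P) := online_state r h' in next_move r (size h') B P n
  else set0.

Section Competitive.
Variables (G : sgraph) (r : G) (f : nat -> nat).
Let s := run firefighter r f.

Lemma run_move i : s i = next_move r i (burning r s i) (protected r s i) (f i).
Proof.
have runE j : s j = let: (B, P) := online_state r (rev (mkseq f j)) in next_move r j B P (f j).
  rewrite /s /run /firefighter mkseqS rev_rcons size_rev size_mkseq.
  by case: online_state.
have stE j : state r s j = online_state r (rev (mkseq f j)).
  elim: j => // j IH; rewrite mkseqS rev_rcons /= -IH size_rev size_mkseq.
  by move: (runE j); rewrite -IH; case: (state r s j) => B P /= ->.
by rewrite /burning /protected stE runE; case: online_state.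
Qed.

Lemma move_legal i B P n : #|next_move r i B P n| <= n /\ [disjoint next_move r i B P n & B :|: P].
Proof.
have none (A : {set G}) : [disjoint set0 & A] by rewrite disjoints_subset sub0set.
rewrite /next_move; case: n => [|m]; first by rewrite cards0 none.
have [->|P0] := eqVneq P set0; last first.
  split; first exact: greedy_le.
  rewrite disjoint_subset; apply/subsetP => z /greedy_sub[zB zP].
  by rewrite !inE negb_or zB.
case: pickP => [x /andP[xB _]|_]; last by rewrite cards0 none.
split.
  apply: leq_trans (leq_card_setU _ _) _; rewrite cards1 add1n ltnS; exact: greedy_le.
rewrite setU0 disjoint_subset; apply/subsetP => z /setU1P[->|/greedy_sub[]] //.
Qed.

Lemma firefighter_legal : legal r f s.
Proof. by move=> i; rewrite run_move; apply: move_legal. Qed.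

Let ls := firefighter_legal.

Lemma greedy_second x t z :
  protected r s t.+1 =
    x |: greedy r (burning r s t) [set x] (\sum_(j < t.+1) f j - 1) ->
  1 < \sum_(j < t.+1) f j -> z \notin burning r s t ->
  #|sep r [set x; z]| <= #|saved r s|.
Proof.
move=> E F2 zb; have xP : x \in protected r s t.+1 by rewrite E setU11.
have fit (P : {set G}) : P \subset protected r s t.+1 -> #|sep r P| <= #|saved r s|.
  by move=> sP; apply: subset_leq_card; apply: subset_trans (sep_mono r sP) (sep_saved ls _).
have [->|zx] := eqVneq z x; first by rewrite setUid fit ?sub1set.
have [||w wg] := @greedy_best G r (burning r s t) [set x] (\sum_(j < t.+1) f j - 1) z _ zb.
- by rewrite subn_gt0.
- by rewrite inE.
rewrite setUC => /leq_trans; apply; apply: fit; rewrite subUset !sub1set xP E andbT.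
by rewrite inE wg orbT.
Qed.

Lemma run_plays_first i x : (forall j, j < i -> f j = 0) -> 0 < f i ->
  [pick x | (x \notin ball r i) && `[< good_first r i (nsqrt #|G|) x >]] = Some x ->
  plays_first r i x f s.
Proof.
move=> f0 fi px; have [Eb Ep] : burning r s i = ball r i /\ protected r s i = set0.
  by rewrite /burning /protected (idle_state ls f0).
have si : s i = x |: greedy r (burning r s i) [set x] (f i).-1.
  by rewrite run_move Eb Ep /next_move; case: (f i) fi => // m _; rewrite eqxx px.
have xi : x \in s i by rewrite si setU11.
have xP j : i < j -> x \in protected r s j.
  move=> ij; apply: (subsetP (protected_sub _ _ ij)).
  by rewrite protectedS inE xi orbT.
have later j : i < j -> s j = greedy r (burning r s j) (protected r s j) (f j).
  move=> /xP xj; rewrite run_move /next_move; case: (f j) => [|m].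
    by apply/eqP; rewrite eq_sym -cards_eq0 -leqn0 greedy_le.
  by case: eqVneq xj => // ->; rewrite inE.
split=> //.
- move=> j; case: (ltngtP j i) => [ji|ij|->].
  + by left; rewrite f0 //; apply/eqP; rewrite -leqn0 -(f0 j ji); case: (ls j).
  + by rewrite protectedS later //; apply: greedy_exhaustive.
  + rewrite protectedS Ep set0U si.
    have [E|->] := greedy_exhaustive r (burning r s i) [set x] (f i).-1; last by right.
    left; rewrite cardsU1 E; have -> : x \notin greedy r (burning r s i) [set x] (f i).-1.
      by apply/negP => /greedy_sub[_]; rewrite inE eqxx.
    by rewrite add1n prednK.
- move=> t z it F1 F2 zb; apply: greedy_second F2 zb.
  move: it; rewrite leq_eqVlt => /predU1P[<-|it].
    by rewrite protectedS Ep set0U si big_ord_recr /= big1 ?add0n ?subn1 // => j _; apply: f0.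
  have P1 : protected r s t = [set x].
    apply/eqP; rewrite eq_sym eqEcard sub1set xP // cards1.
    exact: leq_trans (card_protected_le ls t) F1.
  have Ft : \sum_(j < t) f j = 1.
    apply/eqP; rewrite eqn_leq F1 -(cards1 x) -P1; exact: card_protected_le.
  by rewrite protectedS later // P1 big_ord_recr /= Ft add1n subn1.
Qed.

Lemma saved_full s' i : legal r f s' -> (forall j, j < i -> f j = 0) ->
  ball r i = [set: G] -> saved r s' = set0.
Proof.
move=> ls' f0 full; apply/setP => v; rewrite in_set0; apply/negP => /savedP/(_ i).
by rewrite /burning (idle_state ls' f0) /= full inE.
Qed.

Lemma firefighter_competitive s' : one_almost_tree G -> legal r f s' ->
  #|saved r s'| <= 4 * nsqrt #|G| * #|saved r s|.
Proof.
move=> oat ls'; have [[i0 fi0]|none] := pselect (exists i, 0 < f i); last first.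
  have f0 j : f j = 0 by apply/eqP; rewrite -leqn0 leqNgt; apply/negP => H; apply: none; exists j.
  have [j full] := @ball_full _ r (proj1 oat).
  by rewrite (@saved_full s' j) ?cards0.
have ex : exists i, 0 < f i by exists i0.
case: (ex_minnP ex) => i fi imin.
have f0 j : j < i -> f j = 0.
  by move=> ji; apply/eqP; rewrite -leqn0 leqNgt; apply/negP => /imin; rewrite leqNgt ji.
have [full|nfull] := eqVneq (ball r i) [set: G].
  by rewrite (@saved_full s' i) ?cards0.
have T0 : 0 < nsqrt #|G|.
  have := nsqrt_gt #|G|; case: nsqrt => //; rewrite exp1n ltnS leqn0 => /eqP G0.
  by have := card0_eq G0 r.
case px : [pick x | (x \notin ball r i) && `[< good_first r i (nsqrt #|G|) x >]] => [x|].
  have ps := run_plays_first f0 fi px; move: px; case: pickP => // y /andP[_ /asboolP[_ good]] [E].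
  by apply: good ls'; rewrite E.
have [x [xB good]] := good_first_exists T0 (nsqrt_gt _) oat nfull.
move: px; case: pickP => // /(_ x) /negbT/negP[].
by apply/andP; split=> //; apply/asboolP.
Qed.

End Competitive.

From mathcomp Require Import all_order all_algebra.

(** * The lower bound instances *)

Lemma next_neq_prev (T : eqType) (c : seq T) v : 2 < size c -> uniq c -> v \in c ->
  next c v != prev c v.
Proof.
move=> sc uc vc; have [j q E] := rot_to vc.
rewrite -(next_rot j uc) -(prev_rot j uc) E.
have : uniq (v :: q) by rewrite -E rot_uniq.
have : 2 < size (v :: q) by rewrite -E size_rot.
case: q {E} => [|y [|z q]] // _ /andP[vq /andP[yq _]].
rewrite prev_nth mem_head memNindex // -[size _]/(size [:: v, y, z & q]).-1 nth_last /= eqxx.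
by apply: contraNneq yq => ->; rewrite mem_last.
Qed.

Lemma le_OPT (G : sgraph) (r : G) f (s : strategy G) :
  legal r f s -> #|saved r s| <= OPT r f.
Proof.
move=> ls; have H : #|saved r s| < #|G|.+1 by rewrite ltnS max_card.
have := @leq_bigmax_cond _ (fun k : 'I_#|G|.+1 =>
  `[< exists s, legal r f s /\ #|saved r s| = k >]) (@nat_of_ord _) (Ordinal H).
by apply; apply/asboolP; exists s.
Qed.

Lemma OPT_le (G : sgraph) (r : G) f m :
  (forall s, legal r f s -> #|saved r s| <= m) -> OPT r f <= m.
Proof. by move=> H; apply/bigmax_leqP => k /asboolP[s [/H + <-]]. Qed.

Section RingStar.
Import GRing.Theory.
Local Open Scope ring_scope.
Variables k p : nat.

Definition ring_star_edge (u v : 'I_k.+4 + 'I_p.+1) : bool :=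
  match u, v with
  | inl a, inl b => (b == a + 1) || (a == b + 1)
  | inl a, inr j | inr j, inl a => (a == 0) && (j == ord0)
  | inr j, inr l => (j == ord0) != (l == ord0)
  end.

Lemma ring_star_sym : symmetric ring_star_edge.
Proof.
by case=> [a|j] [b|l] //=; rewrite 1?orbC // eq_sym.
Qed.

Lemma ring_star_irrefl : irreflexive ring_star_edge.
Proof.
case=> [a|j] /=; last by rewrite eqxx.
by rewrite orbb -subr_eq0 opprD addrA subrr sub0r oppr_eq0.
Qed.

Definition ring_star := SGraph ring_star_sym ring_star_irrefl.

Let G := ring_star.
Let root : G := inl 0.
Let hub : G := inr ord0.

Lemma inZpS n : inZp n.+1 = inZp n + 1 :> 'I_k.+4.
Proof. by apply: val_inj; rewrite /= modnDm addn1. Qed.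

Lemma ring_reach (P : {set G}) (a : 'I_k.+4) : root \notin P ->
  (forall b b' : 'I_k.+4, inl b \in P -> inl b' \in P -> b = b') ->
  inl a \notin P -> connect (avoid P) root (inl a).
Proof.
move=> rP P1 aP.
have rE : root = inl (inZp 0) by congr inl; apply: val_inj.
have rE' : root = inl (inZp k.+4) by congr inl; apply: val_inj; rewrite /= modnn.
have up n : (forall b, (b <= n)%N -> inl (inZp b) \notin P) ->
    connect (avoid P) root (inl (inZp n)).
  elim: n => [|n IH] H; first by rewrite -rE connect0.
  apply: connect_trans (IH _) _; first by move=> b bn; apply: H; apply: leqW.
  by apply: connect1; rewrite /avoid /= H // inZpS eqxx.
have down m n : (n + m = k.+4)%N -> (forall b, (n <= b <= k.+4)%N -> inl (inZp b) \notin P) ->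
    connect (avoid P) root (inl (inZp n)).
  elim: m n => [|m IH] n; first by rewrite addn0 => -> _; rewrite -rE' connect0.
  move=> E H; apply: connect_trans (IH n.+1 _ _) _; first by rewrite addSnnS.
    by move=> b /andP[nb bk]; apply: H; rewrite bk ltnW.
  have nk : (n <= k.+4)%N by rewrite -E leq_addr.
  by apply: connect1; rewrite /avoid /= H ?leqnn // inZpS eqxx orbT.
have aE : a = inZp a by rewrite valZpK.
have valb b : (b < k.+4)%N -> (inZp b : 'I_k.+4) = b :> nat.
  by move=> bk; rewrite /= modn_small.
have [low|/existsNP[b /not_implyP[ba /negP]]] :=
    pselect (forall b, (b <= a)%N -> inl (inZp b) \notin P).
  by rewrite aE; apply: up.
rewrite negbK => bP; rewrite aE; apply: (@down (k.+4 - a)%N).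
  by rewrite subnKC // ltnW.
move=> l /andP[al]; rewrite leq_eqVlt => /predU1P[->|lk]; first by rewrite -rE'.
apply/negP => lP; have bk : (b < k.+4)%N by apply: leq_ltn_trans ba (ltn_ord a).
have := P1 _ _ bP lP => /(congr1 (@nat_of_ord _)); rewrite !valb // => E.
have bE : b = a by apply/eqP; rewrite eqn_leq ba E.
by move: bP; rewrite bE -aE (negbTE aP).
Qed.

Lemma star_reach (P : {set G}) j : root \notin P -> (forall l, inr l \notin P) ->
  connect (avoid P) root (inr j).
Proof.
move=> rP sP; apply: (@connect_trans _ _ hub).
  by apply: connect1; rewrite /avoid /= sP.
have [->|j0] := eqVneq j ord0; first exact: connect0.
by apply: connect1; rewrite /avoid /= sP ?eqxx (negbTE j0).
Qed.

Lemma ring_star_connected : connected_graph G.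
Proof.
have sub0 : subrel (connect (avoid (set0 : {set G}))) (connect (@edge G)).
  by apply: connect_sub => x y /andP[xy _]; apply: connect1.
have rc v : connect (@edge G) root v.
  apply: sub0; case: v => [a|j]; last by apply: star_reach => *; rewrite inE.
  by apply: ring_reach; rewrite ?inE // => b b'; rewrite inE.
by move=> u v; apply: connect_trans (rc v); rewrite (sym_connect_sym (@edge_sym G)).
Qed.

Lemma ring_star_cycle (c : seq G) : simple_cycle c ->
  cycle_edges c = [set [set (inl a : G); inl (a + 1)] | a : 'I_k.+4].
Proof.
case/andP=> sc /andP[ec uc].
have en v : v \in c -> edge v (next c v) by apply: next_cycle.
have ep v : v \in c -> edge v (prev c v) by move=> vc; rewrite edgeC; apply: prev_cycle.
have nc v : v \in c -> next c v \in c by rewrite mem_next.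
have pc v : v \in c -> prev c v \in c by rewrite mem_prev.
have np v : v \in c -> next c v != prev c v by apply: next_neq_prev.
have leaf j : j != ord0 -> (inr j : G) \notin c.
  move=> j0; apply/negP => jc.
  have only v : edge (inr j : G) v -> v = hub.
    by case: v => [a|l] /=; rewrite (negbTE j0) ?andbF //; by have [->|] := eqVneq l ord0.
  by have := np _ jc; rewrite (only _ (en _ jc)) (only _ (ep _ jc)) eqxx.
have nhub : hub \notin c.
  apply/negP => hc.
  have only v : v \in c -> edge hub v -> v = root.
    case: v => [a|l] /=; first by move=> _ /andP[/eqP->].
    by have [//|/leaf/negP] := eqVneq l ord0.
  have := np _ hc; rewrite (only _ (nc _ hc) (en _ hc)) (only _ (pc _ hc) (ep _ hc)).
  by rewrite eqxx.
have onring v : v \in c -> exists a, v = inl a.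
  case: v => [a|j] vc; first by exists a.
  by have [j0|/leaf] := eqVneq j ord0; [move: nhub; rewrite /hub -j0 vc|rewrite vc].
have nbr a : inl a \in c ->
    (next c (inl a) = inl (a + 1) /\ prev c (inl a) = inl (a - 1)) \/
    (next c (inl a) = inl (a - 1) /\ prev c (inl a) = inl (a + 1)).
  move=> ac; have [b Eb] := onring _ (nc _ ac); have [d Ed] := onring _ (pc _ ac).
  have := en _ ac; have := ep _ ac; have := np _ ac; rewrite Eb Ed /=.
  have sub1 x : (a == x + 1) = (x == a - 1) by rewrite [RHS]eq_sym subr_eq.
  rewrite !sub1 => bd /orP[]/eqP Hd /orP[]/eqP Hb; subst; rewrite ?eqxx // in bd *;
    by [left|right].
have stepc a : inl a \in c -> inl (a + 1) \in c.
  by move=> ac; case: (nbr a ac) => [[<- _]|[_ <-]]; rewrite ?nc ?pc.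
have allc a : inl a \in c.
  have [a0 a0c] : exists a0, inl a0 \in c.
    case: c sc onring {ec uc en ep nc pc np leaf nhub nbr stepc} => // v c _ /(_ v).
    by rewrite mem_head => -[] // a0 ->; exists a0; rewrite mem_head.
  have E : a = a0 + inZp ((a - a0)%R : 'I_k.+4) by rewrite valZpK addrC subrK.
  rewrite E; elim: (nat_of_ord _) => [|n IH].
    by rewrite (_ : inZp 0 = 0) ?addr0 //; apply: val_inj.
  by rewrite inZpS addrA; apply: stepc.
apply/setP => e; apply/imsetP/imsetP => [[v vc ->]|[a _ ->]].
  have [a Ea] := onring v vc; subst v; have [[-> _]|[-> _]] := nbr a vc; first by exists a.
  by exists (a - 1); rewrite // subrK setUC.
have [[E _]|[_ E]] := nbr a (allc a); first by exists (inl a); rewrite ?E.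
by exists (inl (a + 1)) => //; rewrite setUC -E next_prev.
Qed.

Lemma ring_star_almost_tree : one_almost_tree G.
Proof.
split; first exact: ring_star_connected.
by move=> c1 c2 /ring_star_cycle-> /ring_star_cycle->.
Qed.

Lemma card_ring_star : #|G| = (k.+4 + p.+1)%N.
Proof. by rewrite card_sum !card_ord. Qed.

Definition one_shot (i : nat) : nat := (i == 0)%N.
Definition two_shots (i : nat) : nat := (i < 2)%N.

Lemma legal_set0 (f : nat -> nat) (s : strategy G) i : legal root f s -> f i = 0%N -> s i = set0.
Proof. by move=> ls fi; apply/eqP; rewrite -cards_eq0 -leqn0 -fi; case: (ls i). Qed.

Lemma legal_root (f : nat -> nat) (s : strategy G) i : legal root f s -> root \notin s i.
Proof.
move=> ls; have [_ /disjointFl H] := ls i.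
by rewrite H // inE root_burning.
Qed.

Lemma legal_card1 (f : nat -> nat) (s : strategy G) i u v : legal root f s ->
  u \in s i -> v \in s i -> f i = 1%N -> u = v.
Proof.
by move=> ls ui vi fi; have [+ _] := ls i; rewrite fi => /card_le1_eqP; apply.
Qed.

Lemma saved_one_shot (s : strategy G) : legal root one_shot s ->
  (forall j, inr j \notin s 0%N) -> (#|saved root s| <= 1)%N.
Proof.
move=> ls nj; have [s1 _] := ls 0%N; apply: leq_trans s1; apply: subset_leq_card.
apply/subsetP => v; apply: contraTT => vP; apply: (@burning_avoid _ _ _ (s 0%N)).
  apply: protected_notin => -[|i] //; by rewrite (legal_set0 ls) ?sub0set.
case: v vP => [a|j] vP; last exact: star_reach (legal_root _ ls) nj.
apply: ring_reach vP; first exact: legal_root ls.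
by move=> b b' bP b'P; have [] := legal_card1 ls bP b'P erefl.
Qed.

Lemma saved_two_shots (s : strategy G) j : legal root two_shots s ->
  inr j \in s 0%N -> (#|saved root s| <= p.+2)%N.
Proof.
move=> ls js; have [s1 _] := ls 1%N.
have only a : inl a \notin s 0%N.
  by apply/negP => aj; have := legal_card1 ls js aj erefl.
apply: (@leq_trans #|[set (inr l : G) | l in 'I_p.+1] :|: s 1%N|).
  apply: subset_leq_card; apply/subsetP => v; apply: contraTT.
  rewrite inE negb_or => /andP[vj v1]; apply: (@burning_avoid _ _ _ (s 0%N :|: s 1%N)).
    apply: protected_notin => -[|[|i]]; rewrite ?subsetUl ?subsetUr //.
    by rewrite (legal_set0 ls) ?sub0set.
  case: v vj v1 => [a|l] vj v1; last by case/negP: vj; apply/imsetP; exists l.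
  apply: ring_reach; rewrite ?inE ?negb_or ?(legal_root _ ls) ?only //.
  move=> b b'; rewrite !inE !(negbTE (only _)) /= => b1 b'1.
  by have [] := legal_card1 ls b1 b'1 erefl.
apply: leq_trans (leq_card_setU _ _) _; rewrite -[X in (_ <= X)%N]addn1; apply: leq_add => //.
by rewrite card_imset ?card_ord // => l l' [].
Qed.

Lemma OPT_one_shot : (p.+1 <= OPT root one_shot)%N.
Proof.
pose s : strategy G := fun i => if i is 0%N then [set hub] else set0.
have ls : legal root one_shot s.
  move=> [|i] /=; first by rewrite cards1 burning0 protected0 setU0 disjoints1 inE.
  by rewrite cards0 disjoints_subset sub0set.
apply: leq_trans (le_OPT ls).
rewrite -[p.+1]card_ord -(card_imset _ (inr_inj : injective (inr : 'I_p.+1 -> G))).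
apply: subset_leq_card; apply: subset_trans (sep_saved ls 1); apply/subsetP => v.
case/imsetP => j _ ->; rewrite inE; apply/negP.
pose Q (v : G) : Prop := if v is inl _ then True else False.
apply: (@connect_ind _ _ Q root) => // -[a|l] [b|l'] //= _ /andP[/andP[_ /eqP->]].
by rewrite protectedS protected0 set0U inE eqxx.
Qed.

Lemma OPT_two_shots : (k.+2 <= OPT root two_shots)%N.
Proof.
pose s : strategy G := fun i =>
  match i with 0%N => [set inl 1] | 1%N => [set inl (-1 - 1)] | _ => set0 end.
have m1 : (-1 : 'I_k.+4) != 0 by rewrite oppr_eq0.
have P1 : protected root s 1 = [set inl 1] by rewrite protectedS protected0 set0U.
have P2 : protected root s 2 = [set inl 1; inl (-1 - 1)] by rewrite protectedS P1.
have ls : legal root two_shots s.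
  move=> [|[|i]] /=; last by rewrite cards0 disjoints_subset sub0set.
    by rewrite cards1 burning0 protected0 setU0 disjoints1 inE.
  rewrite cards1 P1; split=> //; rewrite disjoints1 in_setU in_set1 negb_or.
  have two : (1 + 1 : 'I_k.+4) != 0 by [].
  have three : (1 + 1 + 1 : 'I_k.+4) != 0 by [].
  have m2 : (-1 - 1 : 'I_k.+4) != 0 by rewrite -opprD oppr_eq0.
  have m3 : (-1 - 1 : 'I_k.+4) != 1 by rewrite -subr_eq0 -!opprD oppr_eq0.
  apply/andP; split; last by apply: contra m3 => /eqP E; apply/eqP; exact: (inl_inj E).
  apply/negP => b1; case: (@burningSE G root s 0%N _ b1) => [|[_ [u]]];
    rewrite burning0 inE => /eqP.
    by move=> E; case/eqP: m2; exact: (inl_inj E).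
  by move=> -> /= /orP[|]; rewrite ?add0r ?subrK ?(negbTE m3) // eq_sym (negbTE m1).
apply: leq_trans (le_OPT ls).
have E : #|~: [set 0; -1 : 'I_k.+4]| = k.+2.
  by have := cardsC [set 0; -1 : 'I_k.+4]; rewrite cards2 eq_sym m1 card_ord add2n => -[].
rewrite -E -(card_imset _ (inl_inj : injective (inl : 'I_k.+4 -> G))).
apply: subset_leq_card; apply: subset_trans (sep_saved ls 2); apply/subsetP => v.
case/imsetP => a; rewrite !inE negb_or => /andP[a0 a1] ->; apply/negP.
pose Q (v : G) : Prop := if v is inl a then (a == 0) || (a == -1) else True.
suff H : forall v, connect (avoid (protected root s 2)) root v -> Q v.
  by move=> /H /=; rewrite (negbTE a0) (negbTE a1).
apply: (@connect_ind _ _ Q root) => // u {}v {a a0 a1} Qu /andP[uv]; rewrite P2 !inE.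
case: u v uv Qu => [a|j] [b|l] //=; last by move=> /andP[->].
move=> + + /norP[b1 b2].
have {}b1 : b != 1 by apply: contra b1 => /eqP->.
have {}b2 : b != -1 - 1 by apply: contra b2 => /eqP->.
move=> ab /orP[]/eqP aE; move: ab; rewrite aE.
  by rewrite add0r (negbTE b1) -subr_eq sub0r eq_sym => /eqP->; rewrite eqxx orbT.
by rewrite addNr -subr_eq [_ - 1 == b]eq_sym (negbTE b2) orbF => /eqP->.
Qed.

End RingStar.

From mathcomp Require Import lra.
From mathcomp Require Import classical_sets filter reals topology normedtype landau.
Import Order.TTheory GRing.Theory Num.Theory.
Import numFieldNormedType.Exports.

Lemma competitive_firefighter (R : realType) :
  competitive one_almost_tree
    (fun n : nat => 6 * Num.sqrt (n%:R : R) + 1)%R firefighter.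
Proof.
move=> G r f oat; set n := #|G|.
have H : OPT r f <= 4 * nsqrt n * ALG firefighter r f.
  by apply: OPT_le => s; apply: firefighter_competitive.
have sqrt_n : ((nsqrt n)%:R <= Num.sqrt (n%:R : R))%R.
  by rewrite -(@ger0_norm R (nsqrt n)%:R) // -sqrtr_sqr ler_wsqrtr // -natrX ler_nat nsqrt_le.
have s0 := sqrtr_ge0 (n%:R : R).
have : ((OPT r f)%:R <= (4 * nsqrt n * ALG firefighter r f)%:R :> R)%R by rewrite ler_nat.
rewrite !natrM => /le_trans; apply; apply: ler_wpM2r => //; lra.
Qed.

Lemma ring_star_ratio (R : realType) (A : online_rule) (c : nat -> R) (q : nat) :
  online_algorithm one_almost_tree A -> competitive one_almost_tree c A ->
  (q.+1%:R ^+ 2 <= c ((q.+1 ^ 2).+4 + q.+1)%N * q.+2%:R)%R.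
Proof.
move=> onA compA; pose k := q.+1 ^ 2.
have oat := ring_star_almost_tree k q.
pose root : ring_star k q := inl 0%R.
have l1 := onA _ root one_shot oat; have l2 := onA _ root two_shots oat.
have c1 := compA _ root one_shot oat; have c2 := compA _ root two_shots oat.
have same : run A root one_shot 0 = run A root two_shots 0 by [].
rewrite card_ring_star in c1 c2; move: (c _) c1 c2 => x c1 c2.
have x0 : (0 <= x)%R.
  rewrite leNgt; apply/negP => xneg.
  have : (x * (ALG A root one_shot)%:R <= 0)%R by rewrite mulr_le0_ge0 // ltW.
  move/(le_trans c1); rewrite -[0%R]/(0%:R)%R ler_nat leqNgt.
  by rewrite (leq_trans _ (OPT_one_shot k q)).
have [[j jA]|nj] := pselect (exists j, inr j \in run A root one_shot 0).
  have a2 : ALG A root two_shots <= q.+2 by rewrite same in jA; apply: saved_two_shots l2 jA.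
  have o2 := OPT_two_shots k q.
  apply: (@le_trans _ _ (OPT root two_shots)%:R%R).
    by rewrite -natrX ler_nat (leq_trans _ o2) //; apply/leqW/leqnSn.
  apply: le_trans c2 _; apply: ler_wpM2l => //; by rewrite ler_nat.
have a1 : ALG A root one_shot <= 1.
  by apply: saved_one_shot l1 _ => j; apply/negP => jA; apply: nj; exists j.
have qx : (q.+1%:R <= x)%R.
  apply: le_trans (_ : (OPT root one_shot)%:R <= x)%R.
    by rewrite ler_nat OPT_one_shot.
  by apply: le_trans c1 _; rewrite -[leRHS]mulr1 ler_wpM2l // (ler_nat _ _ 1).
by rewrite expr2; apply: ler_pM => //; rewrite ler_nat.
Qed.

Local Open Scope classical_set_scope.
Local Open Scope ring_scope.

Theorem theorem2 (R : realType) :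
  (exists A : online_rule,
     online_algorithm one_almost_tree A /\
     competitive one_almost_tree
       (fun n : nat => 6 * Num.sqrt (n%:R : R) + 1) A) /\
  (forall A : online_rule, online_algorithm one_almost_tree A ->
     ~ exists c : nat -> R,
         c =o_\oo (fun n : nat => Num.sqrt (n%:R : R)) /\
         competitive one_almost_tree c A).
Proof.
split.
  exists firefighter; split; last exact: competitive_firefighter.
  by move=> G r f _; apply: firefighter_legal.
move=> A onA [c [/eqoP co compA]].
have eps : (0 : R) < 1 / 7 by lra.
have [N _ small] := co _ eps.
have ratio := @ring_star_ratio R A c N onA compA.
set n := ((N.+1 ^ 2).+4 + N.+1)%N in ratio.
have Nn : (N <= n)%N by rewrite /n; lia.
have := small n Nn; rewrite /= (ger0_norm (sqrtr_ge0 _)) => cn.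
have q1 : (1 : R) <= N.+1%:R by rewrite (ler_nat _ 1).
have q2 : N.+2%:R = N.+1%:R + 1 :> R by rewrite -addn1 natrD.
have sn : Num.sqrt (n%:R : R) <= 3 * N.+1%:R.
  rewrite -(@ger0_norm R (3 * N.+1%:R)); last by lra.
  rewrite -sqrtr_sqr ler_wsqrtr // /n -addn4 !natrD natrX exprMn; nra.
have {cn}cn := le_trans (ler_norm _) cn.
rewrite q2 in ratio; move: q1 ratio sn cn; move: (N.+1%:R) (c n) (Num.sqrt _) => q x s; nra.
Qed.
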